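(* Let $G$ be a $7$-regular Ramanujan graph with $n\geq 22$ vertices. Then $G$ is globally rigid in $\mathbb{R}^2$. Let $G$ be a $6$-regular Ramanujan graph with $n\geq 329$ vertices. Then $G$ is globally rigid in $\mathbb{R}^2$.
   Context: All graphs are finite and simple. For $k\geq 3$, a connected $k$-regular graph $G$ on $n$ vertices is a Ramanujan graph if every eigenvalue $\lambda$ of its adjacency matrix with $\lambda\neq \pm k$ satisfies $|\lambda|\leq 2\sqrt{k-1}$. A $d$-dimensional framework is a pair $(G,p)$ with $p:V(G)\to\mathbb{R}^d$; it is generic if the coordinates of all $p(v)$ are algebraically independent over $\mathbb{Q}$. Frameworks $(G,p)$ and $(G,q)$ are equivalent if $\|p(u)-p(v)\|=\|q(u)-q(v)\|$ for every edge $uv$, and congruent if this holds for all pairs $u,v\in V(G)$. A framework is globally rigid if every framework equivalent to it is congruent to it. A graph $G$ is globally rigid in $\mathbb{R}^d$ if some (equivalently every) generic framework $(G,p)$ in $\mathbb{R}^d$ is globally rigid. *)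

(* Defs.v *)
(* The notations of mpoly clash with those of mathcomp-analysis; mpoly comes
   first because it has its own symmetric. *)
From mathcomp Require Import -(notations) mpoly.
From mathcomp Require Import all_boot all_order all_algebra.
From mathcomp Require Import reals.

Set Implicit Arguments.
Unset Strict Implicit.
Unset Printing Implicit Defensive.

Import Order.TTheory GRing.Theory Num.Theory.
Local Open Scope ring_scope.

Record sgraph (V : finType) := SGraph {
  adj :> rel V;
  adj_sym : symmetric adj;
  adj_irrefl : irreflexive adj
}.

Definition connected (V : finType) (G : sgraph V) : Prop :=
  forall u v : V, connect G u v.

Definition regular (V : finType) (G : sgraph V) (k : nat) : Prop :=
  forall v : V, #|[set w | G v w]| = k.

Definition adjmx (R : realType) (V : finType) (G : sgraph V) : 'M[R]_#|V| :=
  \matrix_(i, j) (G (enum_val i) (enum_val j))%:R.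

(* The adjacency matrix is real symmetric, so its eigenvalues in R are all of
   its complex eigenvalues. *)
Definition ramanujan (R : realType) (V : finType) (G : sgraph V) (k : nat) :
    Prop :=
  [/\ (3 <= k)%N, connected G, regular G k &
      forall a : R, eigenvalue (adjmx R G) a -> a != k%:R -> a != - k%:R ->
        `|a| <= 2 * Num.sqrt (k%:R - 1)].

Definition alg_independent (R : realType) (I : finType) (x : I -> R) : Prop :=
  forall P : mpoly #|I| rat,
    meval (fun i => x (enum_val i)) (map_mpoly ratr P) = 0 ->
    P = 0.

(* The library norm on 'rV[R]_d is the sup norm, hence this definition. *)
Definition enorm (R : realType) (d : nat) (x : 'rV[R]_d) : R :=
  Num.sqrt (\sum_i x 0 i ^+ 2).

Definition generic (R : realType) (d : nat) (V : finType) (p : V -> 'rV[R]_d) :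
    Prop :=
  alg_independent (fun vi : V * 'I_d => p vi.1 0 vi.2).

Definition equivalent (R : realType) (d : nat) (V : finType) (G : sgraph V)
    (p q : V -> 'rV[R]_d) : Prop :=
  forall u v : V, G u v -> enorm (p u - p v) = enorm (q u - q v).

Definition congruent (R : realType) (d : nat) (V : finType)
    (p q : V -> 'rV[R]_d) : Prop :=
  forall u v : V, enorm (p u - p v) = enorm (q u - q v).

Definition fw_globally_rigid (R : realType) (d : nat) (V : finType)
    (G : sgraph V) (p : V -> 'rV[R]_d) : Prop :=
  forall q : V -> 'rV[R]_d, equivalent G p q -> congruent p q.

Definition globally_rigid (R : realType) (V : finType) (G : sgraph V)
    (d : nat) : Prop :=
  exists p : V -> 'rV[R]_d, generic p /\ fw_globally_rigid G p.

(* Main.v *)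
From HB Require Import structures.
From mathcomp Require Import -(notations) mpoly.
Require Import Defs.
From mathcomp Require Import all_boot all_order all_algebra.
From mathcomp Require Import boolp reals.
From mathcomp Require classical_sets cardinality constructive_ereal.
From mathcomp Require lebesgue_measure complex.
From mathcomp Require Import zify ring lra.

Set Implicit Arguments.
Unset Strict Implicit.
Unset Printing Implicit Defensive.

Import Order.TTheory GRing.Theory Num.Theory.

(* The proof is by algebraic independence and a count of edges.
   (1) Suppose that G - v is rigid for every v, that G is connected and that all
   degrees are at least 3.  Let p be generic, q equivalent to p, and a, b, e
   three neighbours of v.  After an isometry fixing q a = 0 and q b = (s, 0), the
   remaining coordinates of q on G - v are algebraic over Q(p(G - v)): the
   squared lengths of 2(n-1)-3 independent edges are algebraically independent
   (Jacobian criterion), and there are only 2(n-1)-3 such coordinates.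
   Subtracting the length equations at v, one gets q v as an affine function of
   p v - p a with coefficients algebraic over Q(p(G - v)).  As p v is
   transcendental over this field, |p v - p a|^2 = |q v - q a|^2 becomes a
   polynomial identity, and its constant term gives |p a - p b| = |q a - q b|.
   So having the same distance in p and in q is a transitive relation containing G
   (the argument is due to Tanigawa).
   (2) By Laman's theorem G - v is rigid if it has a spanning (2,3)-tight
   subgraph.  Otherwise its edges are covered by proper vertex sets X with
   \sum (2 #|X| - 3) <= 2 n - 6, whereas the spectral bound on the number of
   edges inside X (the expander mixing inequality) leaves too few edges. *)

(** * Sparse and tight edge sets *)

Section Sparse.
Variable V : finType.
Implicit Types (F E : {set {set V}}) (X Y : {set V}) (e : {set V}) (u v : V).

Definition edges_in F X := [set e in F | e \subset X].

Definition ecount F X := #|edges_in F X|.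

(** This is (2,3)-sparsity, Laman's count; the 3 stands on the left to avoid truncated
    subtraction. *)
Definition sparse F :=
  [forall e in F, #|e| == 2] &&
  [forall X : {set V}, (1 < #|X|) ==> (ecount F X + 3 <= 2 * #|X|)].

Definition tight F X := (1 < #|X|) && (ecount F X + 3 == 2 * #|X|).

Lemma sparseP F : reflect
  ((forall e, e \in F -> #|e| = 2) /\
   (forall X, 1 < #|X| -> ecount F X + 3 <= 2 * #|X|)) (sparse F).
Proof.
apply: (iffP andP) => -[H1 H2]; split.
- by move=> e /(forall_inP H1)/eqP.
- by move=> X; move/forallP: H2 => /(_ X)/implyP.
- by apply/forall_inP => e /H1 ->.
- by apply/forallP => X; apply/implyP/H2.
Qed.

Lemma sparse_card2 F e : sparse F -> e \in F -> #|e| = 2.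
Proof. by move=> /sparseP[H _]; apply: H. Qed.

Lemma edges_inS F X Y : X \subset Y -> edges_in F X \subset edges_in F Y.
Proof.
move=> sXY; apply/subsetP => e; rewrite !inE => /andP[-> /=].
by move=> h; apply: subset_trans h sXY.
Qed.

Lemma edges_inI F X Y : edges_in F (X :&: Y) = edges_in F X :&: edges_in F Y.
Proof. by apply/setP => e; rewrite !inE subsetI; case: (e \in F). Qed.

(** Supermodularity: an edge inside both sets lies inside the intersection, and the union may
    contain further edges. *)
Lemma edges_in_setU F X Y :
  ecount F X + ecount F Y <=
  ecount F (X :|: Y) + ecount F (X :&: Y).
Proof.
rewrite -cardsUI -edges_inI leq_add2r subset_leq_card //.
by rewrite subUset !edges_inS ?subsetUl ?subsetUr.
Qed.

(** Supermodularity of [ecount] against modularity of cardinality leaves no slack. Two shared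
    vertices make the sparsity bound available for the intersection. *)
Lemma tight_setU F X Y : sparse F -> tight F X -> tight F Y ->
  1 < #|X :&: Y| -> tight F (X :|: Y).
Proof.
move=> /sparseP[_ spF] /andP[X1 /eqP tX] /andP[Y1 /eqP tY] XY1.
have U1 : 1 < #|X :|: Y|.
  by apply: leq_trans X1 _; rewrite subset_leq_card ?subsetUl.
rewrite /tight U1 /=.
have := spF _ XY1; have := spF _ U1; have := edges_in_setU F X Y.
have := cardsUI X Y; lia.
Qed.

Lemma sparse_sub F E : F \subset E -> sparse E -> sparse F.
Proof.
move=> sFE /sparseP[c2 sp]; apply/sparseP; split=> [e eF|X X1].
  by apply: c2; apply: (subsetP sFE).
apply: leq_trans (sp X X1); rewrite leq_add2r subset_leq_card //.
by apply/subsetP => e; rewrite !inE => /andP[/(subsetP sFE) -> ->].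
Qed.

(** Only sets containing [e] gain an edge, and none of them is at its bound. *)
Lemma sparse_setU1 F e : sparse F -> #|e| = 2 -> e \notin F ->
  (forall X, e \subset X -> ~~ tight F X) -> sparse (e |: F).
Proof.
move=> /sparseP[c2 sp] e2 eF nt; apply/sparseP; split=> [f|X X1].
  by rewrite in_setU1 => /predU1P[->//|/c2].
have [eX|eX] := boolP (e \subset X); last first.
  rewrite /ecount; suff -> : edges_in (e |: F) X = edges_in F X by apply: sp.
  apply/setP => f; rewrite !inE; case: eqP => // ->.
  by rewrite (negPf eX) (negPf eF).
have -> : ecount (e |: F) X = (ecount F X).+1.
  have eFX : e \notin edges_in F X by rewrite inE (negPf eF).
  rewrite /ecount -add1n; have := cardsU1 e (edges_in F X); rewrite eFX => <-.
  by apply: eq_card => f; rewrite !inE; case: eqP => // ->; rewrite eX.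
have := nt X eX; rewrite /tight X1 /=; have := sp X X1; lia.
Qed.

Lemma tight_edge F e : sparse F -> e \in F -> tight F e.
Proof.
move=> spF eF; have e2 := sparse_card2 spF eF.
move/sparseP: spF => [_ /(_ e)]; rewrite /tight e2 => /(_ isT) h /=.
have : 0 < ecount F e by apply/card_gt0P; exists e; rewrite !inE eF subxx.
by lia.
Qed.

(** In a maximal sparse [F], an edge outside [F] that lay in no tight set could still be added; an
    edge of [F] is itself a tight set. *)
Lemma ex_max_sparse E : (forall e, e \in E -> #|e| = 2) ->
  exists F, [/\ F \subset E, sparse F &
    forall e, e \in E -> exists2 X, tight F X & e \subset X].
Proof.
move=> E2; have sp0 : (set0 \subset E) && sparse set0.
  rewrite sub0set /=; apply/sparseP; split=> [e|X X1]; first by rewrite inE.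
  suff -> : ecount set0 X = 0 by lia.
  by apply: eq_card0 => e; rewrite !inE.
have [F /maxsetP[/andP[sFE spF] Fmax] _] :=
  @maxset_exists _ (fun F => (F \subset E) && sparse F) set0 sp0.
exists F; split=> // e eE.
have [eF|eF] := boolP (e \in F); first by exists e; rewrite ?tight_edge.
case: (pickP (fun X => tight F X && (e \subset X))) => [X /andP[]|no].
  by exists X.
have /Fmax h : (e |: F \subset E) && sparse (e |: F).
  rewrite subUset sub1set eE sFE /=; apply: sparse_setU1 => //; first exact: E2.
  by move=> X eX; have := no X; rewrite eX andbT => ->.
by move: eF; rewrite -(h (subsetUr _ _)) !inE eqxx.
Qed.

(* The maximal tight sets play the role of the rigid components: they cover E
   and partition F. *)
Lemma tight_cover E (S : {set V}) : 1 < #|S| ->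
  (forall e, e \in E -> #|e| = 2) -> (forall e, e \in E -> e \subset S) ->
  (exists F, [/\ F \subset E, sparse F & #|F| + 3 = 2 * #|S|]) \/
  exists T : {set {set V}}, [/\
    forall X, X \in T -> [/\ X \subset S, 1 < #|X| & #|X| < #|S|],
    #|E| <= \sum_(X in T) ecount E X &
    (\sum_(X in T) (2 * #|X| - 3)) + 4 <= 2 * #|S|].
Proof.
move=> S1 E2 ES; have [F [sFE spF cov]] := ex_max_sparse E2.
have inS : edges_in F S = F.
  apply/setP => e; rewrite inE; apply: andb_idr.
  by move/(subsetP sFE); apply: ES.
have [tS|ntS] := boolP (tight F S).
  by left; exists F; split=> //; move/andP: tS => [_ /eqP]; rewrite /ecount inS.
right; pose P X := (X \subset S) && tight F X; exists [set X | maxset P X].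
have TP X : X \in [set X | maxset P X] -> P X.
  by rewrite inE => /maxsetP[].
have Peq e : e \in E -> exists2 X, maxset P X & e \subset X.
  move=> eE; have [X tX eX] := cov _ eE.
  (* All edges of [F] lie inside [S], so cutting [X] down to [S] loses no edge and keeps it
     tight. *)
  have PX : P (X :&: S).
    rewrite /P subsetIr /= /tight.
    have eqI : ecount F (X :&: S) = ecount F X.
      rewrite /ecount edges_inI inS; congr #|pred_of_set _|.
      by apply/setIidPl/subsetP => f; rewrite inE => /andP[].
    move/andP: tX => [X1 /eqP tX].
    have X1' : 1 < #|X :&: S|.
      by rewrite -(E2 e eE) subset_leq_card // subsetI eX ES.
    rewrite X1' /= eqI.
    have := subset_leq_card (subsetIl X S).
    have [_ /(_ _ X1')] := sparseP _ spF; rewrite eqI.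
    by lia.
  have [Y mY sY] := maxset_exists PX; exists Y => //.
  by apply: subset_trans sY; rewrite subsetI eX ES.
split.
- move=> X /TP /andP[sXS tX]; split=> //; first by case/andP: tX.
  rewrite ltn_neqAle subset_leq_card // andbT; apply: contra ntS => /eqP h.
  suff -> : S = X by [].
  by apply/esym/eqP; rewrite eqEcard sXS h leqnn.
- have sub : E \subset \bigcup_(X in [set X | maxset P X]) edges_in E X.
    apply/subsetP => e eE; have [X mX eX] := Peq e eE.
    by apply/bigcupP; exists X; rewrite ?inE ?eE.
  apply: leq_trans (subset_leq_card sub) _.
  elim/big_rec2: _ => [|X m A _ h]; first by rewrite cards0.
  by apply: leq_trans (leq_card_setU _ _) _; rewrite leq_add2l.
have -> : \sum_(X in [set X | maxset P X]) (2 * #|X| - 3) =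
          \sum_(X in [set X | maxset P X]) ecount F X.
  by apply: eq_bigr => X /TP /andP[_ /andP[_ /eqP]]; lia.
(* Maximal tight sets sharing an edge of [F] meet in two vertices, so their union is tight and they
   coincide. *)
have triv : trivIset [set edges_in F X | X in [set X | maxset P X]].
  apply/trivIsetP => _ _ /imsetP[X mX ->] /imsetP[Y mY ->] nXY.
  rewrite -setI_eq0; apply: contraR nXY => /set0Pn[e].
  rewrite -edges_inI inE => /andP[eF sXY]; apply/eqP; congr edges_in.
  have c2 : 1 < #|X :&: Y| by rewrite -(sparse_card2 spF eF) subset_leq_card.
  have /andP[sX tX] := TP X mX; have /andP[sY tY] := TP Y mY.
  have PU : P (X :|: Y) by rewrite /P subUset sX sY /= tight_setU.
  move: mX mY; rewrite !inE => /maxsetP[_ hX] /maxsetP[_ hY].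
  by rewrite -(hX _ PU (subsetUl _ _)) {1}(hY _ PU (subsetUr _ _)).
have inj : {in [set X | maxset P X] &, injective (edges_in F)}.
  move=> X Y mX mY h.
  have /andP[sX tX] := TP X mX; have /andP[sY tY] := TP Y mY.
  (* A tight set contains at least one edge, so equal edge sets share one and the previous argument
     applies. *)
  have : 0 < ecount F X.
    move/andP: (tX) => [X1 /eqP]; clear -X1; lia.
  move=> /card_gt0P[e eX]; have : e \in edges_in F (X :&: Y).
    by rewrite edges_inI inE eX -h eX.
  rewrite inE => /andP[eF sXY].
  have c2 : 1 < #|X :&: Y| by rewrite -(sparse_card2 spF eF) subset_leq_card.
  have PU : P (X :|: Y) by rewrite /P subUset sX sY /= tight_setU.
  move: mX mY; rewrite !inE => /maxsetP[_ hX] /maxsetP[_ hY].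
  by rewrite -(hX _ PU (subsetUl _ _)) {1}(hY _ PU (subsetUr _ _)).
have -> : \sum_(X in [set X | maxset P X]) ecount F X =
   \sum_(A in [set edges_in F X | X in [set X | maxset P X]]) #|A|.
  by rewrite big_imset.
rewrite (eqP triv).
have : #|cover [set edges_in F X | X in [set X | maxset P X]]| <= #|F|.
  apply: subset_leq_card; apply/bigcupsP => A /imsetP[X _ ->].
  by apply/subsetP => e; rewrite inE => /andP[].
have [_ /(_ _ S1)] := sparseP _ spF; move: ntS; rewrite /tight S1 /ecount inS /=.
by lia.
Qed.


(** * Degrees in a sparse edge set *)

Definition star F v := [set e in F | v \in e].
Definition nbrs F v := [set u | [set v; u] \in F].

Lemma sparse_nbr_neq F v u : sparse F -> u \in nbrs F v -> u != v.
Proof.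
by rewrite inE => spF /(sparse_card2 spF); rewrite cards2 eq_sym; case: eqP.
Qed.

Lemma set2_inj v u w : [set v; u] = [set v; w] -> u = w.
Proof.
move=> h; have : u \in [set v; w] by rewrite -h !inE eqxx orbT.
rewrite !inE => /orP[/eqP uv|/eqP//].
by have : w \in [set v; u] by [rewrite h !inE eqxx orbT]; rewrite uv setUid inE => /eqP.
Qed.

Lemma card_nbrs F v : sparse F -> #|nbrs F v| = #|star F v|.
Proof.
move=> spF; rewrite -(card_imset _ (@set2_inj v)); apply: eq_card => e.
apply/imsetP/idP => [[u uF ->]|].
  by move: uF; rewrite !inE eqxx => ->.
rewrite inE => /andP[eF ve].
have : #|e :\ v| == 1 by have := cardsD1 v e; rewrite ve (sparse_card2 spF eF); lia.
case/cards1P => u eu; have eE : e = [set v; u] by rewrite -eu setD1K.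
by exists u => //; rewrite inE -eE.
Qed.

Lemma star_nbr F v e : sparse F -> e \in star F v ->
  exists2 u, u \in nbrs F v & e = [set v; u].
Proof.
move=> spF; rewrite inE => /andP[eF ve].
have : #|e :\ v| == 1 by have := cardsD1 v e; rewrite ve (sparse_card2 spF eF); lia.
case/cards1P => u eu; have eE : e = [set v; u] by rewrite -eu setD1K.
by exists u => //; rewrite inE -eE.
Qed.

(** Handshake: over the set [S] of covered vertices the degrees sum to [2 * #|F|], at most
    [4 * #|S| - 6], so they cannot all be at least 4. *)
Lemma sparse_degree F : sparse F -> F != set0 ->
  exists v, 0 < #|nbrs F v| <= 3.
Proof.
move=> spF /set0Pn[e0 e0F]; have [c2 sp] := sparseP _ spF.
set S := cover F.
have FS e : e \in F -> e \subset S by move=> eF; apply: (bigcup_sup e).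
have eFS : ecount F S = #|F|.
  apply: eq_card => e; rewrite inE; apply: andb_idr; apply: FS.
have S1 : 1 < #|S| by rewrite -(c2 _ e0F) subset_leq_card ?FS.
have deg : \sum_(v in S) #|star F v| = 2 * #|F|.
  have -> : \sum_(v in S) #|star F v| = \sum_(v in S) \sum_(e in F) (v \in e : nat).
    by apply: eq_bigr => v _; rewrite -sum1_card big_mkcond [RHS]big_mkcond /=;
      apply: eq_bigr => e _; rewrite inE; case: (e \in F) => //; case: (v \in e).
  rewrite exchange_big /= mulnC -sum_nat_const; apply: eq_bigr => e eF.
  rewrite -(c2 e eF) -sum1_card big_mkcond [RHS]big_mkcond /=; apply: eq_bigr => v _.
  by have := subsetP (FS e eF) v; case: (v \in e) => [->|_] //; case: (v \in S).
have [/exists_inP[v vS dv]|] := boolP [exists v in S, #|star F v| <= 3].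
  exists v; rewrite card_nbrs // dv andbT; case/bigcupP: vS => e eF ve.
  by apply/card_gt0P; exists e; rewrite inE eF.
rewrite negb_exists_in => /forall_inP h.
have : \sum_(v in S) 4 <= \sum_(v in S) #|star F v|.
  by apply: leq_sum => v vS; have := h v vS; rewrite -ltnNge.
rewrite deg sum_nat_const; have := sp S S1; rewrite eFS; lia.
Qed.

Lemma nin_del_star F v e : e \in F :\: star F v -> v \notin e.
Proof. by rewrite !inE; case: (e \in F) => //; rewrite andbT. Qed.

(** * Undoing a Henneberg step at a vertex of degree three *)

Section Henneberg.
Variables (F : {set {set V}}) (v a b c : V).
Hypotheses (spF : sparse F) (nbv : nbrs F v = [set a; b; c])
  (nab : a != b) (nac : a != c) (nbc : b != c).
Let F' := F :\: star F v.

Lemma sparse_del_star : sparse F'.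
Proof. exact: sparse_sub (subsetDl _ _) spF. Qed.

(** No edge of [F'] meets [v], so [X :\ v] would keep all edges of [X] and break the bound, which
    applies because [x] and [y] remain. *)
Lemma tight_del_star X x y : tight F' X -> x \in X -> y \in X -> x != y ->
  x != v -> y != v -> v \notin X.
Proof.
move=> /andP[_ /eqP tX] xX yX nxy xv yv; apply/negP => vX.
have e1 : ecount F' (X :\ v) = ecount F' X.
  apply: eq_card => e; rewrite [LHS]in_set [RHS]in_set subsetD1.
  by have [/nin_del_star ->|//] := boolP (e \in F'); rewrite andbT.
have c1 : 1 < #|X :\ v|.
  have <- : #|[set x; y]| = 2 by rewrite cards2 nxy.
  apply: subset_leq_card; apply/subsetP => z; rewrite !inE.
  by case/orP => /eqP ->; rewrite ?xX ?yX ?xv ?yv.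
have [_ /(_ _ c1)] := sparseP _ sparse_del_star.
by rewrite e1; have := cardsD1 v X; rewrite vX; clear -tX; lia.
Qed.

(** Adding [v] to [X] would bring three edges of [F] but raise the bound by only two. *)
Lemma no_tight_nbrs X : tight F' X ->
  a \in X -> b \in X -> c \in X -> False.
Proof.
move=> tX aX bX cX.
have nv x : x \in [set a; b; c] -> x != v by rewrite -nbv; apply: sparse_nbr_neq.
have vX : v \notin X.
  by apply: (tight_del_star tX aX bX nab); apply: nv; rewrite !inE eqxx ?orbT.
move/andP: tX => [X1 /eqP tX].
have U1 : 1 < #|v |: X| by rewrite cardsU1 vX; lia.
have [_ /(_ _ U1)] := sparseP _ spF; rewrite cardsU1 vX.
suff : ecount F' X + #|[set [set v; u] | u in [set a; b; c]]| <= ecount F (v |: X).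
  rewrite (card_imset _ (@set2_inj v)) -setUA cardsU1 cards2 !inE (negPf nab) (negPf nac) nbc /=.
  by lia.
rewrite -cardsUI [X in _ + X]eq_card0 ?addn0; last first.
  move=> e; rewrite inE; apply/negP => /andP[h /imsetP[u _ eu]].
  move: h; rewrite inE => /andP[/nin_del_star].
  by rewrite eu !inE eqxx.
apply: subset_leq_card; apply/subsetP => e /setUP[|/imsetP[u uN ->]].
  rewrite !inE => /andP[/andP[_ ->] eX] /=.
  by apply: subset_trans eX _; rewrite subsetUr.
move: (uN); rewrite -nbv !inE => -> /=.
apply/subsetP => x; rewrite !inE => /orP[->//|/eqP ->].
by move: uN; rewrite !inE => /orP[/orP[]|] /eqP ->; rewrite ?aX ?bX ?cX orbT.
Qed.

Lemma tight_or_addable x y : x != y ->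
  ([set x; y] \notin F' /\ sparse ([set x; y] |: F')) \/
  exists X, [/\ tight F' X, x \in X & y \in X].
Proof.
move=> nxy; have c2 : #|[set x; y]| = 2 by rewrite cards2 nxy.
have [eF|eF] := boolP ([set x; y] \in F').
  right; exists [set x; y].
  by rewrite tight_edge ?sparse_del_star // !inE !eqxx ?orbT.
case: (pickP (fun X => tight F' X && ([set x; y] \subset X))) => [X|no].
  rewrite subUset !sub1set => /and3P[tX xX yX]; by right; exists X.
left; split=> //; apply: sparse_setU1 => //; first exact: sparse_del_star.
by move=> X eX; have := no X; rewrite eX andbT => ->.
Qed.

Lemma small_edges_in0 X : #|X| <= 1 -> edges_in F' X = set0.
Proof.
move=> X1; apply/setP => e; rewrite [LHS]inE [RHS]inE; apply/negP => /andP[eF eX].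
by have := subset_leq_card eX; rewrite (sparse_card2 sparse_del_star eF); lia.
Qed.

(** If every pair of neighbours lay in a tight set, two of these sets could share only one vertex,
    as otherwise their union would be tight and contain all of [a], [b], [c]. But then the union of
    all three is tight by counting. *)
Lemma henneberg_tight : exists x y z,
  [/\ [set x; y; z] = [set a; b; c], x != y & [/\ x != z, y != z,
      [set x; y] \notin F' & sparse ([set x; y] |: F')]].
Proof.
have [[h1 h2]|[X [tX aX bX]]] := tight_or_addable nab; first by exists a, b, c.
have [[h1 h2]|[Y [tY bY cY]]] := tight_or_addable nbc.
  exists b, c, a; split=> //; last by split=> //; rewrite eq_sym.
  by apply/setP => x; rewrite !inE orbC orbA.
have [[h1 h2]|[Z [tZ aZ cZ]]] := tight_or_addable nac.
  exists a, c, b; split=> //; last by split=> //; rewrite eq_sym.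
  by apply/setP => x; rewrite !inE orbAC.
exfalso; have spF' := sparse_del_star.
have one A B : tight F' A -> tight F' B -> a \in A :|: B -> b \in A :|: B ->
    c \in A :|: B -> #|A :&: B| <= 1.
  move=> tA tB aU bU cU; rewrite leqNgt; apply/negP => c1.
  by apply: (no_tight_nbrs (tight_setU spF' tA tB c1)).
have XY1 : #|X :&: Y| <= 1 by apply: one; rewrite // inE ?aX ?bX ?cY ?orbT.
have XZ1 : #|X :&: Z| <= 1 by apply: one; rewrite // inE ?aX ?bX ?cZ ?orbT.
have YZ1 : #|Y :&: Z| <= 1 by apply: one; rewrite // inE ?aZ ?bY ?cZ ?orbT.
have cU : ecount F' X + ecount F' Y + ecount F' Z <= ecount F' (X :|: Y :|: Z).
  have XY0 : edges_in F' X :&: edges_in F' Y = set0.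
    by rewrite -edges_inI small_edges_in0.
  have U0 : (edges_in F' X :|: edges_in F' Y) :&: edges_in F' Z = set0.
    by rewrite setIUl -!edges_inI !small_edges_in0 // setU0.
  have := cardsUI (edges_in F' X) (edges_in F' Y); rewrite XY0 cards0 addn0.
  move=> /esym h; rewrite /ecount h.
  have := cardsUI (edges_in F' X :|: edges_in F' Y) (edges_in F' Z).
  rewrite U0 cards0 addn0 => <-.
  apply: subset_leq_card; rewrite !subUset !edges_inS ?subsetUr //.
  - exact: subset_trans (subsetUr _ _) (subsetUl _ _).
  - exact: subset_trans (subsetUl _ _) (subsetUl _ _).
have XYi : #|X :&: Y| = 1.
  by apply/eqP; rewrite eqn_leq XY1 card_gt0; apply/set0Pn; exists b; rewrite inE bX.
(* The union thus has at most [#|X| + #|Y| + #|Z| - 3] vertices, and its at least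
   [2 * (#|X| + #|Y| + #|Z|) - 9] edges reach the bound. *)
have U2 : #|(X :|: Y) :&: Z| >= 2.
  have <- : #|[set a; c]| = 2 by rewrite cards2 nac.
  by apply: subset_leq_card; rewrite subUset !sub1set !inE aX cY aZ cZ !orbT.
apply: (@no_tight_nbrs (X :|: Y :|: Z)); rewrite ?inE ?aX ?bX ?cY ?orbT //.
have U1 : 1 < #|X :|: Y :|: Z|.
  have <- : #|[set a; c]| = 2 by rewrite cards2 nac.
  by apply: subset_leq_card; rewrite subUset !sub1set !inE aX cY !orbT.
rewrite /tight U1 /=; have [_ /(_ _ U1)] := sparseP _ spF'.
move: tX tY tZ => /andP[_ /eqP tX] /andP[_ /eqP tY] /andP[_ /eqP tZ].
have := cardsUI X Y; have := cardsUI (X :|: Y) Z.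
by clear -tX tY tZ cU XYi U2; lia.
Qed.

End Henneberg.

End Sparse.

(** * The rigidity matrix *)

Local Open Scope ring_scope.

(** * Evaluation of rational polynomials at real points *)

Section Evaluation.
Variables (R : realType).

Definition ratev n (f : 'I_n -> R) (P : mpoly n rat) : R :=
  meval f (map_mpoly ratr P).

Fact ratev_is_zmod_morphism n (f : 'I_n -> R) : zmod_morphism (ratev f).
Proof. by move=> P Q; rewrite /ratev !rmorphB. Qed.
HB.instance Definition _ n (f : 'I_n -> R) :=
  GRing.isZmodMorphism.Build _ _ (ratev f) (ratev_is_zmod_morphism f).
Fact ratev_is_monoid_morphism n (f : 'I_n -> R) : monoid_morphism (ratev f).
Proof. by split=> [|P Q]; rewrite /ratev ?rmorph1 ?rmorphM. Qed.
HB.instance Definition _ n (f : 'I_n -> R) :=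
  GRing.isMonoidMorphism.Build _ _ (ratev f) (ratev_is_monoid_morphism f).

Lemma ratev_X n (f : 'I_n -> R) i : ratev f (mpolyX rat (mnm1 i)) = f i.
Proof. by rewrite /ratev map_mpolyX mevalXU. Qed.

Lemma ratev_C n (f : 'I_n -> R) c : ratev f (mpolyC n c) = ratr c.
Proof. by rewrite /ratev map_mpolyC mevalC. Qed.

Lemma ratevZ n (f : 'I_n -> R) c P : ratev f (c *: P) = ratr c * ratev f P.
Proof. by rewrite -mul_mpolyC rmorphM /= ratev_C. Qed.

Lemma ratev_Xm n (f : 'I_n -> R) m : ratev f (mpolyX rat m) = \prod_i f i ^+ m i.
Proof. by rewrite /ratev map_mpolyX mevalX. Qed.

Definition mev (I : finType) (x : I -> R) (P : mpoly #|I| rat) : R :=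
  ratev (fun i => x (enum_val i)) P.

HB.instance Definition _ (I : finType) (x : I -> R) :=
  GRing.RMorphism.copy (mev x) (ratev (fun i => x (enum_val i))).

Lemma mevB (I : finType) (x : I -> R) P Q : mev x (P - Q) = mev x P - mev x Q.
Proof. exact: rmorphB. Qed.

Lemma mevM (I : finType) (x : I -> R) P Q : mev x (P * Q) = mev x P * mev x Q.
Proof. exact: rmorphM. Qed.

Definition mvar (I : finType) (i : I) : mpoly #|I| rat :=
  mpolyX rat (mnm1 (enum_rank i)).

Lemma mev_var (I : finType) (x : I -> R) i : mev x (mvar i) = x i.
Proof. by rewrite /mev /mvar ratev_X enum_rankK. Qed.

(** This is how genericity is used: one point [x'], possibly very special, where [P] does not vanish
    is enough. *)
Lemma alg_independent_neq0 (I : finType) (x x' : I -> R) P :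
  alg_independent x -> mev x' P != 0 -> mev x P != 0.
Proof. by move=> gx; apply: contra_neq => /gx ->; rewrite rmorph0. Qed.

End Evaluation.

Section RigidityMatrix.
Variables (A : comNzRingType) (V : finType).
Implicit Types (F : {set {set V}}) (c : V -> 'I_2 -> A).

(** The ring is arbitrary so that the matrix also exists over the polynomials. The sum over [w]
    selects the other end of the edge. *)
Definition rigmx c F : 'M[A]_(#|F|, #|{: V * 'I_2}|) :=
  \matrix_(i, j) \sum_w (enum_val i == [set (enum_val j).1; w])%:R *
     (c (enum_val j).1 (enum_val j).2 - c w (enum_val j).2).

End RigidityMatrix.

Section Independence.
Variables (R : realType) (V : finType).
Implicit Types (F : {set {set V}}) (c : V -> 'I_2 -> R) (w : {set V} -> R).

Definition coords c := fun vi : V * 'I_2 => c vi.1 vi.2.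

(* An edge is a set of two vertices; the terms with u = v vanish. *)
Definition stress c F w := (forall e, e \notin F -> w e = 0) /\
  (forall u k, \sum_v w [set u; v] * (c u k - c v k) = 0).

Definition indep c F := forall w, stress c F w -> forall e, w e = 0.

Lemma rigmx_mul c F (w : {set V} -> R) j : (forall e, e \notin F -> w e = 0) ->
  ((\row_i w (enum_val i)) *m rigmx c F) 0 j =
  \sum_v w [set (enum_val j).1; v] * (c (enum_val j).1 (enum_val j).2 - c v (enum_val j).2).
Proof.
move=> wF; rewrite mxE.
under eq_bigr do rewrite !mxE big_distrr /=.
rewrite exchange_big /=; apply: eq_bigr => v _.
under eq_bigr do rewrite mulrA.
rewrite -big_distrl /=; congr (_ * _).
rewrite -(big_enum_val (fun e => w e * (e == [set (enum_val j).1; v])%:R)) /=.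
have [eF|eF] := boolP ([set (enum_val j).1; v] \in F).
  rewrite (bigD1 _ eF) /= eqxx mulr1 big1 ?addr0 // => e /andP[_ /negPf ->].
  by rewrite mulr0.
rewrite (wF _ eF) big1 // => e eF'; case: eqP => [eE|]; last by rewrite mulr0.
by rewrite -eE eF' in eF.
Qed.

(** Stresses are the vectors of the left kernel of the rigidity matrix. *)
Lemma indep_row_free c F : indep c F <-> row_free (rigmx c F).
Proof.
split=> [ind|free w [wF wS] e].
  rewrite -kermx_eq0; apply/rowV0P => x /sub_kermxP x0.
  pose w e := \sum_i x 0 i * (enum_val i == e)%:R.
  have wF e : e \notin F -> w e = 0.
    move=> eF; apply: big1 => i _; case: eqP => [ei|]; last by rewrite mulr0.
    by rewrite -ei enum_valP in eF.
  have wx : x = \row_i w (enum_val i).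
    apply/rowP => i; rewrite mxE /w (bigD1 i) //= eqxx mulr1 big1 ?addr0 //.
    by move=> j /negPf ji; rewrite (inj_eq enum_val_inj) ji mulr0.
  suff w0 : forall e, w e = 0 by rewrite wx; apply/rowP => i; rewrite !mxE w0.
  apply: ind; split=> // u k.
  have := rigmx_mul c (enum_rank (u, k)) wF.
  by rewrite -wx x0 mxE enum_rankK => <-.
have [eF|/wF//] := boolP (e \in F).
have /rowP/(_ (enum_rank_in eF e)) : \row_i w (enum_val i) = 0 :> 'rV_#|F|.
  apply: (row_free_inj free); rewrite mul0mx; apply/rowP => j.
  by rewrite rigmx_mul // wS mxE.
by rewrite !mxE enum_rankK_in.
Qed.

(** If [x *m M *m M^T = 0], the squares of the entries of [x *m M] sum to zero. Independence thereby
    becomes the nonvanishing of a single determinant. *)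
Lemma gram_row_free m n (M : 'M[R]_(m, n)) :
  row_free M = (\det (M *m M^T) != 0).
Proof.
rewrite -unitfE -unitmxE -row_free_unit; apply/idP/idP => free.
  rewrite -kermx_eq0; apply/rowV0P => x /sub_kermxP x0.
  apply: (row_free_inj free); rewrite mul0mx.
  have : ((x *m M) *m (x *m M)^T) 0 0 = 0.
    by rewrite trmx_mul !mulmxA -(mulmxA x) x0 mul0mx mxE.
  rewrite mxE; under eq_bigr do rewrite [X in _ * X]mxE -expr2.
  move=> /psumr_eq0P h; apply/rowP => j; apply/eqP.
  by rewrite [X in _ == X]mxE -sqrf_eq0 h // => i _; rewrite sqr_ge0.
rewrite -kermx_eq0; apply/rowV0P => x /sub_kermxP x0.
by apply: (row_free_inj free); rewrite mulmxA x0 !mul0mx.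
Qed.

(** The Gram determinant of the rigidity matrix is a rational polynomial in the coordinates. *)
Lemma indep_generic c c' F :
  alg_independent (coords c) -> indep c' F -> indep c F.
Proof.
move=> gc; rewrite !indep_row_free !gram_row_free.
pose M := rigmx (fun v k => mvar (v, k)) F : 'M[mpoly #|{: V * 'I_2}| rat]_(_, _).
have ME d : rigmx d F = map_mx (mev (coords d)) M.
  apply/matrixP => i j; rewrite !mxE rmorph_sum /=; apply: eq_bigr => v _.
  by rewrite rmorphM rmorphB rmorph_nat /= !mev_var.
rewrite !ME !matrix.map_trmx -!map_mxM !det_map_mx.
exact: alg_independent_neq0.
Qed.

End Independence.

(** * Laman's theorem *)

Section Laman.
Variables (R : realType) (V : finType).
Implicit Types (F : {set {set V}}) (c : V -> 'I_2 -> R) (w : {set V} -> R).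

(** Twice the signed area of the triangle [a b d]: it vanishes exactly on collinear triples. *)
Definition cross c (a b d : V) : R :=
  (c b 0 - c a 0) * (c d 1 - c a 1) - (c b 1 - c a 1) * (c d 0 - c a 0).

Lemma generic_cross c a b d : alg_independent (coords c) ->
  a != b -> a != d -> b != d -> cross c a b d != 0.
Proof.
move=> gc nab nad nbd.
pose m u k : mpoly #|{: V * 'I_2}| rat := mvar (u, k).
pose D := (m b 0 - m a 0) * (m d 1 - m a 1) - (m b 1 - m a 1) * (m d 0 - m a 0).
have DE (c' : V -> 'I_2 -> R) : mev (coords c') D = cross c' a b d.
  by rewrite /D rmorphB !rmorphM !rmorphB /= /m !mev_var.
(* The witness puts [a] at the origin and [b], [d] at the two unit vectors. *)
pose c' u (k : 'I_2) : R := ((u == b) && (k == 0))%:R + ((u == d) && (k == 1))%:R.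
rewrite -DE; apply: (alg_independent_neq0 gc (x' := coords c')).
rewrite DE /cross /c' !eqxx /= !andbF !andbT (negPf nab) (negPf nad) (eq_sym d).
by rewrite (negPf nbd) /=; apply/eqP; lra.
Qed.

Lemma generic_neq c a b (k : 'I_2) : alg_independent (coords c) ->
  a != b -> c a k - c b k != 0.
Proof.
move=> gc nab; pose c' u (_ : 'I_2) : R := (u == a)%:R.
pose D : mpoly #|{: V * 'I_2}| rat := mvar (a, k) - mvar (b, k).
have DE (d : V -> 'I_2 -> R) : mev (coords d) D = d a k - d b k.
  by rewrite /D rmorphB /= !mev_var.
rewrite -DE; apply: (alg_independent_neq0 gc (x' := coords c')).
by rewrite DE /c' eqxx (eq_sym b) (negPf nab) subr0 oner_neq0.
Qed.

Lemma stress_nbrs c F w v k : stress c F w ->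
  \sum_(u in nbrs F v) w [set v; u] * (c v k - c u k) = 0.
Proof.
move=> [wF wE]; rewrite -[RHS](wE v k) [LHS]big_mkcond; apply: eq_bigr => u _.
by rewrite inE; case: ifPn => // /wF ->; rewrite mul0r.
Qed.

Lemma stress_del c F w v : sparse F -> stress c F w ->
  (forall u, u \in nbrs F v -> w [set v; u] = 0) -> stress c (F :\: star F v) w.
Proof.
move=> spF [wF wS] w0; split=> // e.
rewrite inE negb_and negbK => /orP[/(star_nbr spF)[u uN ->]|/wF//].
exact: w0.
Qed.

Lemma card_del_star F v : sparse F ->
  (#|F :\: star F v| + #|nbrs F v| = #|F|)%N.
Proof.
move=> spF; rewrite card_nbrs // addnC -(cardsID (star F v) F); congr (_ + _)%N.
by apply: eq_card => e; rewrite !inE; case: (e \in F).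
Qed.

Lemma cramer0 (x y p1 p2 q1 q2 : R) : x * p1 + y * q1 = 0 -> x * p2 + y * q2 = 0 ->
  p1 * q2 - p2 * q1 != 0 -> x = 0 /\ y = 0.
Proof.
move=> e1 e2 D; split; apply: (mulIf D); rewrite mul0r.
  transitivity ((x * p1 + y * q1) * q2 - (x * p2 + y * q2) * q1); first by ring.
  by rewrite e1 e2; ring.
transitivity ((x * p2 + y * q2) * p1 - (x * p1 + y * q1) * p2); first by ring.
by rewrite e1 e2; ring.
Qed.

(* The edges at v stay independent when v is moved to the midpoint of x and y:
   there the edges v x and v y together replace the edge x y. *)
Lemma indep_one_extension c F v x y z : alg_independent (coords c) -> sparse F ->
  nbrs F v = [set x; y; z] -> x != y -> x != z -> y != z ->
  [set x; y] \notin F :\: star F v ->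
  indep c ([set x; y] |: (F :\: star F v)) -> indep c F.
Proof.
move=> gc spF nbv nxy nxz nyz xyF ind.
have nv u : u \in [set x; y; z] -> u != v by rewrite -nbv; apply: sparse_nbr_neq.
have xv : x != v by apply: nv; rewrite !inE eqxx.
have yv : y != v by apply: nv; rewrite !inE eqxx !orbT.
have zv : z != v by apply: nv; rewrite !inE eqxx !orbT.
pose c' u k := if u == v then (c x k + c y k) / 2 else c u k.
apply: (@indep_generic _ _ _ c') => // w wS; have [wF wE] := wS.
pose al := w [set v; x]; pose be := w [set v; y]; pose ga := w [set v; z].
have vE k : al * (c y k - c x k) / 2 + be * (c x k - c y k) / 2 +
    ga * ((c x k + c y k) / 2 - c z k) = 0.
  have := stress_nbrs v k wS; rewrite nbv.
  rewrite -setUA big_setU1 /= ?inE ?negb_or ?nxy ?nxz //.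
  rewrite big_setU1 ?inE //= big_set1 /c' eqxx (negPf xv) (negPf yv) (negPf zv).
  by rewrite -/al -/be -/ga => <-; field.
(* As [x], [y], [z] are not collinear, the line [x y] and the direction from [z] to the midpoint are
   independent. Equilibrium at [v] therefore forces equal stresses on [v x] and [v y] and none on
   [v z]. *)
have [ab0 ga0] : (al - be) / 2 = 0 /\ ga = 0.
  apply: (@cramer0 _ _ (c y 0 - c x 0) (c y 1 - c x 1)
    ((c x 0 + c y 0) / 2 - c z 0) ((c x 1 + c y 1) / 2 - c z 1)).
  - by rewrite -(vE 0); field.
  - by rewrite -(vE 1); field.
  have := generic_cross gc nxy nxz nyz; rewrite /cross.
  by apply: contra_neq => h; rewrite -[RHS]oppr0 -h; field.
have abE : be = al by lra.
have vN u : u \notin [set x; y; z] -> w [set v; u] = 0.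
  by rewrite -nbv inE => /wF.
(* An edge from [x] or [y] to the midpoint with stress [al] acts there like the edge [x y] with
   stress [al / 2]. *)
pose w' (e : {set V}) := if v \in e then 0 else w e + (e == [set x; y])%:R * (al / 2).
have vxy : v \notin [set x; y] by rewrite !inE negb_or eq_sym xv eq_sym yv.
have xyF' : [set x; y] \notin F.
  by apply: contra xyF => h; apply/setDP; rewrite in_set (negPf vxy) andbF.
have w'S : stress c ([set x; y] |: (F :\: star F v)) w'.
  split=> [e|u k].
    rewrite /w'; case: ifPn => // ve; rewrite !inE negb_or.
    move=> /andP[/negPf -> ]; rewrite negb_and negbK (negPf ve) andbF /= => /wF ->.
    by rewrite mul0r addr0.
  have [->|uv] := eqVneq u v.
    by apply: big1 => t _; rewrite /w' !inE eqxx mul0r.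
  have h : w [set v; u] * (c u k - (c x k + c y k) / 2) +
      \sum_(t | t != v) w [set u; t] * (c' u k - c' t k) = 0.
    by rewrite -[RHS](wE u k) [RHS](bigD1 v) //= {3 4}/c' (negPf uv) eqxx setUC.
  rewrite (bigD1 v) //= {1}/w' set22 mul0r add0r.
  have -> : \sum_(t | t != v) w' [set u; t] * (c u k - c t k) =
     \sum_(t | t != v) w [set u; t] * (c' u k - c' t k) +
     \sum_(t | t != v) ([set u; t] == [set x; y])%:R * (al / 2) * (c u k - c t k).
    rewrite -big_split; apply: eq_bigr => t tv /=.
    rewrite /w' /c' !inE ![v == _]eq_sym (negPf uv) (negPf tv) /=.
    by rewrite mulrDl.
  move/eqP: h; rewrite [X in X == 0]addrC addr_eq0 => /eqP ->; rewrite addrC.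
  have setE t : ([set u; t] == [set x; y]) = (u == x) && (t == y) || (u == y) && (t == x).
    apply/eqP/idP => [e|/orP[]/andP[/eqP-> /eqP->] //]; last by rewrite setUC.
    have [ux|ux] := eqVneq u x; first by rewrite ux in e; rewrite (set2_inj e) !eqxx.
    have : x \in [set u; t] by rewrite e set21.
    rewrite !inE eq_sym (negPf ux) /= => /eqP tx; rewrite -tx eqxx andbT.
    have : y \in [set u; x] by rewrite tx e set22.
    by rewrite !inE [y == x]eq_sym (negPf nxy) orbF eq_sym.
  have [ux|ux] := eqVneq u x.
    rewrite (bigD1 y) //= big1 ?addr0.
      by rewrite setE ux !eqxx mul1r -/al; field.
    by move=> t /andP[_ /negPf ty]; rewrite setE ty andbF ux (negPf nxy) !mul0r.
  have [uy|uy] := eqVneq u y.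
    rewrite (bigD1 x) //= big1 ?addr0.
      by rewrite setE uy !eqxx orbT mul1r -/be abE; field.
    by move=> t /andP[_ /negPf tx]; rewrite setE tx andbF (negPf ux) !mul0r.
  rewrite big1 ?add0r; last by move=> t _; rewrite setE (negPf ux) (negPf uy) !mul0r.
  have [->|uz] := eqVneq u z; first by rewrite -/ga ga0 mul0r oppr0.
  by rewrite vN ?mul0r ?oppr0 // !inE (negPf ux) (negPf uy) (negPf uz).
have w'0 := ind _ w'S.
have al0 : al = 0.
  have := w'0 [set x; y]; rewrite /w' (negPf vxy) eqxx wF // mul1r add0r.
  by move=> h; lra.
move=> e; have [ve|ve] := boolP (v \in e); last first.
  by have := w'0 e; rewrite /w' (negPf ve) al0 mul0r mulr0 addr0.
have [eF|/wF//] := boolP (e \in F).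
have /(star_nbr spF)[u] : e \in star F v by rewrite inE eF.
rewrite nbv !inE => /orP[/orP[]|] /eqP -> ->; rewrite -?/al -?/be -?/ga ?abE //.
Qed.

(** Induction on the number of edges, at a vertex [v] with at most three neighbours. With one or two
    of them the edge directions at [v] are linearly independent, so the stresses there vanish; with
    three, the Henneberg step gives a smaller sparse set. *)
Theorem laman c F : alg_independent (coords c) -> sparse F -> indep c F.
Proof.
move=> gc; have [n] := ubnP #|F|; elim: n F => // n IH F /ltnSE leFn spF.
have [F0|F0] := eqVneq F set0.
  by move=> w [wF _] e; apply: wF; rewrite F0 inE.
have [v /andP[N0 N3]] := sparse_degree spF F0.
have cdel := card_del_star v spF.
have spD : sparse (F :\: star F v) := sparse_sub (subsetDl _ _) spF.
have indD : indep c (F :\: star F v).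
  by apply: IH spD; apply: leq_trans leFn; rewrite -cdel -addn1 leq_add2l.
have nv u : u \in nbrs F v -> v != u.
  by rewrite eq_sym; apply: sparse_nbr_neq.
have [N1|N1] := leqP #|nbrs F v| 1.
  have /cards1P[a Na] : #|nbrs F v| == 1%N by rewrite eqn_leq N1.
  move=> w wS; apply: indD; apply: stress_del => // u; rewrite Na inE => /eqP ->.
  have := stress_nbrs v 0 wS; rewrite Na big_set1 => /eqP.
  have va : v != a by apply: nv; rewrite Na inE.
  by rewrite mulf_eq0 (negPf (generic_neq 0 gc va)) orbF => /eqP.
have [N2|N2] := leqP #|nbrs F v| 2.
  have /cards2P[a [b [nab Nab]]] : #|nbrs F v| == 2%N by rewrite eqn_leq N2.
  move=> w wS; apply: indD; apply: stress_del => //.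
  have va : v != a by apply: nv; rewrite Nab !inE eqxx.
  have vb : v != b by apply: nv; rewrite Nab !inE eqxx orbT.
  have E k := stress_nbrs v k wS.
  have [h1 h2] : w [set v; a] = 0 /\ w [set v; b] = 0.
    apply: (@cramer0 _ _ (c v 0 - c a 0) (c v 1 - c a 1) (c v 0 - c b 0) (c v 1 - c b 1)).
    - by have := E 0; rewrite Nab big_setU1 ?inE //= big_set1.
    - by have := E 1; rewrite Nab big_setU1 ?inE //= big_set1.
    have := generic_cross gc va vb nab; apply: contra_neq; rewrite /cross => <-; ring.
  by move=> u; rewrite Nab !inE => /orP[]/eqP->.
have N3' : #|nbrs F v| = 3%N by apply/eqP; rewrite eqn_leq N3.
have /card_gt0P[a aN] := N0.
have : #|nbrs F v :\ a| == 2%N by have := cardsD1 a (nbrs F v); rewrite aN N3'; lia.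
case/cards2P => b [d [nbd Nbd]].
have Nabd : nbrs F v = [set a; b; d] by rewrite -(setD1K aN) Nbd setUA.
have nab : a != b.
  by have : b \in nbrs F v :\ a by [rewrite Nbd !inE eqxx]; rewrite !inE eq_sym => /andP[].
have nad : a != d.
  by have : d \in nbrs F v :\ a by [rewrite Nbd !inE eqxx orbT]; rewrite !inE eq_sym => /andP[].
have [x [y [z [sE nxy [nxz nyz xyF spH]]]]] := henneberg_tight spF Nabd nab nad nbd.
apply: (indep_one_extension gc spF _ nxy nxz nyz xyF); first by rewrite Nabd sE.
apply: IH spH; rewrite cardsU1 xyF; apply: leq_trans leFn.
by rewrite -cdel N3' addn3 add1n.
Qed.

End Laman.

(** * Algebraic independence of edge lengths *)

Lemma mderiv_X n (i j : 'I_n) :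
  mderiv j (mpolyX rat (mnm1 i)) = (i == j)%:R.
Proof.
rewrite mderivX mnm1E; case: eqP => [->|_]; last by rewrite scale0r.
rewrite scale1r; suff -> : mnm_sub (mnm1 j) (mnm1 j) = @mnm0 n by rewrite mpolyX0.
by apply/mnmP => k; rewrite !mnmE subnn.
Qed.

(** * The chain rule for polynomial substitution *)

Section Chain.
Variables (n m : nat) (g : 'I_m -> mpoly n rat).

Definition msubst (P : mpoly m rat) : mpoly n rat :=
  comp_mpoly [tuple g i | i < m] P.

HB.instance Definition _ :=
  GRing.RMorphism.copy msubst (comp_mpoly [tuple g i | i < m]).

Lemma msubst_X i : msubst (mpolyX rat (mnm1 i)) = g i.
Proof. by rewrite /msubst comp_mpolyXU -tnth_nth tnth_mktuple. Qed.

Lemma msubstZ c P : msubst (c *: P) = c *: msubst P.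
Proof. exact: comp_mpolyZ. Qed.

Lemma ratev_msubst (R : realType) (z : 'I_n -> R) P :
  ratev z (msubst P) = ratev (fun i => ratev z (g i)) P.
Proof.
elim/mpolyind: P => [|c k p _ _ IH]; first by rewrite !rmorph0.
rewrite !rmorphD /= IH; congr (_ + _); rewrite msubstZ !ratevZ; congr (_ * _).
rewrite /msubst comp_mpolyX rmorph_prod ratev_Xm; apply: eq_bigr => i _.
by rewrite rmorphXn tnth_mktuple.
Qed.

(** The property passes to products and linear combinations, so it only has to be checked on
    variables. *)
Lemma mderiv_msubst j P :
  mderiv j (msubst P) = \sum_i msubst (mderiv i P) * mderiv j (g i).
Proof.
pose Q P := mderiv j (msubst P) = \sum_i msubst (mderiv i P) * mderiv j (g i).
have QX i : Q (mpolyX rat (mnm1 i)).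
  rewrite /Q msubst_X (bigD1 i) //= mderiv_X eqxx rmorph1 mul1r big1 ?addr0 //.
  by move=> k ki; rewrite mderiv_X eq_sym (negPf ki) rmorph0 mul0r.
have Q1 : Q 1.
  rewrite /Q rmorph1 mderivC big1 // => i _.
  by rewrite mderivC rmorph0 mul0r.
have QM a b : Q a -> Q b -> Q (a * b).
  rewrite /Q rmorphM mderivM => -> ->; rewrite mulr_suml mulr_sumr -big_split /=.
  by apply: eq_bigr => i _; rewrite mderivM /= rmorphD !rmorphM /=; ring.
have Qm k : Q (mpolyX rat k).
  rewrite mpolyXE_id; apply: big_ind => // i _.
  by elim: (k i) => [|e IH]; rewrite ?expr0 // exprS; apply: QM.
rewrite -/(Q P); elim/mpolyind: P => [|c k p _ _ IH].
  by rewrite /Q rmorph0 mderiv0 big1 // => i _; rewrite mderiv0 rmorph0 mul0r.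
rewrite /Q rmorphD /= mderivD IH msubstZ mderivZ (Qm k) scaler_sumr -big_split /=.
apply: eq_bigr => i _.
by rewrite mderivD mderivZ rmorphD /= msubstZ mulrDl scalerAl.
Qed.

End Chain.

(** Here [mmeasure mdeg] is the degree plus one, and 0 for the zero polynomial. *)
Lemma msize_leP n (P : mpoly n rat) N :
  (forall m, (N <= mdeg m)%N -> mcoeff m P = 0) -> (mmeasure mdeg P <= N)%N.
Proof.
move=> h; rewrite msizeE; apply/bigmax_leqP_seq => m mP _; rewrite ltnNge.
by apply: contraTN mP => /h/eqP; rewrite mcoeff_eq0.
Qed.

Lemma mcoeff_msize n (P : mpoly n rat) m :
  (mmeasure mdeg P <= mdeg m)%N -> mcoeff m P = 0.
Proof. by move=> /msize_mdeg_ge /memN_msupp_eq0. Qed.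

Lemma msize_mderiv n (P : mpoly n rat) i N :
  (mmeasure mdeg P <= N.+1)%N -> (mmeasure mdeg (mderiv i P) <= N)%N.
Proof.
move=> h; apply: msize_leP => m Nm; rewrite mcoeff_mderiv mcoeff_msize ?mul0rn //.
by apply: leq_trans h _; rewrite mdegD mdeg1 addn1.
Qed.

(** In characteristic zero the coefficient of a nonconstant monomial survives, up to a positive
    integer factor, in some partial derivative. *)
Lemma mderiv_eq0 n (P : mpoly n rat) : (forall i, mderiv i P = 0) ->
  P = mpolyC n (mcoeff (@mnm0 n) P).
Proof.
move=> dP; apply/mpolyP => m; rewrite mcoeffC.
have [->|m0] := eqVneq m (@mnm0 n); first by rewrite mulr1.
rewrite mulr0.
have [i mi] : exists i, (0 < m i)%N.
  apply/existsP; apply: contraR m0 => /existsPn h; apply/eqP/mnmP => i.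
  by rewrite mnm0E; have := h i; rewrite lt0n negbK => /eqP.
have := congr1 (mcoeff (mnm_sub m (mnm1 i))) (dP i); rewrite mcoeff_mderiv mcoeff0.
rewrite submK; last by apply/mnm_lepP => k; rewrite mnm1E; case: eqP => // <-.
by move/eqP; rewrite mulrn_eq0 /= => /eqP.
Qed.

Section Jacobian.
Variables (V : finType).

Definition sqd (A : comNzRingType) (c : V -> 'I_2 -> A) (u w : V) : A :=
  \sum_k (c u k - c w k) ^+ 2.

(* Twice the squared length of the edge e, as each edge has two orientations. *)
Definition sqlen (A : comNzRingType) (c : V -> 'I_2 -> A) (e : {set V}) : A :=
  \sum_u \sum_w ([set u; w] == e)%:R * sqd c u w.

Lemma eq_sqlen (A : comNzRingType) (c d : V -> 'I_2 -> A) e :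
  (forall u w, [set u; w] = e -> sqd c u w = sqd d u w) -> sqlen c e = sqlen d e.
Proof.
move=> cd; apply: eq_bigr => u _; apply: eq_bigr => w _.
by case: eqP => [/cd->//|_]; rewrite !mul0r.
Qed.

Lemma sqlen_rmorph (A B : comNzRingType) (h : {rmorphism A -> B}) c e :
  h (sqlen c e) = sqlen (fun u k => h (c u k)) e.
Proof.
rewrite /sqlen rmorph_sum; apply: eq_bigr => u _.
rewrite rmorph_sum; apply: eq_bigr => w _.
rewrite rmorphM rmorph_nat rmorph_sum; congr (_ * _); apply: eq_bigr => k _.
by rewrite rmorphXn rmorphB.
Qed.

Local Notation pcoord := (fun u k => mvar (u, k) : mpoly #|{: V * 'I_2}| rat).

(** The Jacobian of the squared lengths is a multiple of the rigidity matrix: one factor 2 comes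
    from the square, another from the two orientations of an edge. *)
Lemma mderiv_sqlen (e : {set V}) u0 k0 :
  mderiv (enum_rank (u0, k0)) (sqlen pcoord e) =
  4%:R * \sum_w (e == [set u0; w])%:R * (mvar (u0, k0) - mvar (w, k0)).
Proof.
have dv u k : mderiv (enum_rank (u0, k0)) (mvar (u, k)) =
    ((u == u0) && (k == k0))%:R :> mpoly #|{: V * 'I_2}| rat.
  by rewrite /mvar mderiv_X (inj_eq enum_rank_inj).
have dn (b : bool) (P : mpoly #|{: V * 'I_2}| rat) :
    mderiv (enum_rank (u0, k0)) (b%:R * P) = b%:R * mderiv (enum_rank (u0, k0)) P.
  by case: b; rewrite ?mul1r ?mul0r ?mderiv0.
pose B u w : mpoly #|{: V * 'I_2}| rat :=
  ([set u; w] == e)%:R * (mvar (u, k0) - mvar (w, k0)).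
have BN u w : B u w = - B w u by rewrite /B setUC -mulrN opprB.
have -> : mderiv (enum_rank (u0, k0)) (sqlen pcoord e) =
    \sum_u \sum_w 2%:R * ((u == u0)%:R - (w == u0)%:R) * B u w.
  rewrite /sqlen raddf_sum /=; apply: eq_bigr => u _.
  rewrite raddf_sum /=; apply: eq_bigr => w _; rewrite dn raddf_sum /=.
  rewrite (bigD1 k0) //= [X in _ + X]big1 ?addr0 => [|k /negPf kk0].
    by rewrite expr2 mderivM mderivB !dv eqxx !andbT /B; ring.
  by rewrite expr2 mderivM mderivB !dv kk0 !andbF subr0 mulr0 mul0r addr0.
transitivity (\sum_u \sum_w (2%:R * ((u == u0)%:R * B u w) + 2%:R * ((w == u0)%:R * B w u))).
  by apply: eq_bigr => u _; apply: eq_bigr => w _; rewrite (BN w u); ring.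
under eq_bigr do rewrite big_split /=.
rewrite big_split /= [X in _ + X]exchange_big /=.
have -> : \sum_u \sum_w 2%:R * ((u == u0)%:R * B u w) = \sum_w 2%:R * B u0 w.
  rewrite (bigD1 u0) //= [X in _ + X]big1 ?addr0 => [|u /negPf uu0].
    by apply: eq_bigr => w _; rewrite eqxx mul1r.
  by apply: big1 => w _; rewrite uu0 mul0r mulr0.
rewrite -big_split mulr_sumr /=; apply: eq_bigr => w _.
by rewrite /B [_ == e]eq_sym; ring.
Qed.

(* In a relation P of minimal degree, the values of the partial derivatives of P
   form a stress, hence vanish. *)
Theorem sqlen_alg_independent (R : realType) (c : V -> 'I_2 -> R) F :
  alg_independent (coords c) -> indep c F ->
  forall P : mpoly #|F| rat, ratev (fun i => sqlen c (enum_val i)) P = 0 -> P = 0.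
Proof.
move=> gc ind P.
pose g (i : 'I_#|F|) := sqlen pcoord (enum_val i).
have gE i : mev (coords c) (g i) = sqlen c (enum_val i).
  by rewrite /g sqlen_rmorph; apply: eq_sqlen => u w _;
    apply: eq_bigr => k _; rewrite /= !mev_var.
have [N] := ubnP (mmeasure mdeg P); elim: N P => // N IH P /ltnSE lePN P0.
have Pg : msubst g P = 0.
  apply: gc; rewrite -/(ratev _ _) ratev_msubst -[RHS]P0 /ratev.
  by apply: mpoly.meval_eq => i; exact: gE.
have dP i : mderiv i P = 0.
  case: N lePN IH => [|N] lePN IH.
    suff -> : P = 0 by rewrite mderiv0.
    by apply/eqP; rewrite -msize_poly_eq0 -leqn0.
  apply: IH; first by rewrite ltnS; apply: msize_mderiv.
  pose v := \row_i ratev (fun i => sqlen c (enum_val i)) (mderiv i P) : 'rV[R]_#|F|.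
  suff /rowP/(_ i) : v = 0 by rewrite !mxE.
  move/indep_row_free: ind => free; apply: (row_free_inj free).
  rewrite mul0mx; apply/rowP => j; rewrite !mxE.
  (* Differentiating the identity [Pg] puts [v] in the left kernel of the rigidity matrix, up to the
     factor 4. *)
  have := congr1 (mev (coords c) \o mderiv j) Pg; rewrite /= mderiv0 rmorph0.
  rewrite mderiv_msubst rmorph_sum => h.
  suff h4 : 4%:R * \sum_i0 v 0 i0 * rigmx c F i0 j = 0.
    by move/eqP: h4; rewrite mulf_eq0 pnatr_eq0 => /eqP.
  rewrite -[RHS]h mulr_sumr; apply: eq_bigr => i0 _.
  rewrite rmorphM /= [X in _ = X * _]ratev_msubst mulrCA mxE; congr (_ * _).
    by apply: mpoly.meval_eq => k; rewrite -gE.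
  rewrite /g -(enum_valK j); case: (enum_val j) => u k.
  rewrite mderiv_sqlen rmorphM rmorph_nat rmorph_sum mxE enum_rankK /=; congr (_ * _).
  by apply: eq_bigr => w _; rewrite rmorphM rmorphB rmorph_nat /= !mev_var.
have := mderiv_eq0 dP => PC; move: P0; rewrite PC ratev_C => /eqP.
by rewrite fmorph_eq0 => /eqP ->; rewrite mpolyC0.
Qed.

End Jacobian.

(** * Dependence of many polynomials in few variables *)

Section Counting.
Variable n : nat.

Definition mnm_of_fun B (k : {ffun 'I_n -> 'I_B}) : multinom n :=
  Multinom [tuple (k i : nat) | i < n].

Lemma mnm_of_funE B (k : {ffun 'I_n -> 'I_B}) i : mnm_of_fun k i = k i.
Proof. exact: mnmE. Qed.

Lemma mnm_of_fun_inj B : injective (@mnm_of_fun B).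
Proof.
move=> k l kl; apply/ffunP => i; apply: val_inj.
by rewrite /= -!mnm_of_funE kl.
Qed.

(** All exponents are at most [B], which leaves at most [B.+1 ^ n] monomials. *)
Lemma mpoly_lin_dep B (J : finType) (h : J -> mpoly n rat) :
  (forall j, mmeasure mdeg (h j) <= B.+1)%N -> (B.+1 ^ n < #|J|)%N ->
  exists a : J -> rat, (exists j, a j != 0) /\ \sum_j a j *: h j = 0.
Proof.
move=> hB ltJ.
pose M : 'M[rat]_(#|J|, #|{ffun 'I_n -> 'I_B.+1}|) :=
  \matrix_(i, k) mcoeff (mnm_of_fun (enum_val k)) (h (enum_val i)).
have : kermx M != 0.
  rewrite kermx_eq0 /row_free neq_ltn (leq_ltn_trans (rank_leq_col M)) //.
  by rewrite card_ffun !card_ord.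
case/rowV0Pn => x /sub_kermxP xM x0.
exists (fun j => x 0 (enum_rank j)); split.
  have [i xi] : exists i, x 0 i != 0.
    apply/existsP; apply: contraR x0 => /existsPn x0; apply/eqP/rowP => i.
    by rewrite mxE; have := x0 i; rewrite negbK => /eqP.
  by exists (enum_val i); rewrite enum_valK.
apply/mpolyP => m; rewrite mcoeff0 raddf_sum /=.
have [mB|] := leqP (mdeg m) B; last first.
  move=> Bm; apply: big1 => j _; rewrite mcoeffZ mcoeff_msize ?mulr0 //.
  exact: leq_trans (hB j) Bm.
have mlt i : (m i < B.+1)%N.
  by rewrite ltnS; apply: leq_trans mB; rewrite mdegE (bigD1 i) //= leq_addr.
pose k := [ffun i => Ordinal (mlt i)] : {ffun 'I_n -> 'I_B.+1}.
have mk : m = mnm_of_fun k by apply/mnmP => i; rewrite mnm_of_funE ffunE.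
have /rowP/(_ (enum_rank k)) := xM; rewrite !mxE => {2}<-.
rewrite (reindex (@enum_val J predT)) /=; last exact/onW_bij/enum_val_bij.
by apply: eq_bigr => i _; rewrite mcoeffZ enum_valK mxE enum_rankK -mk.
Qed.

Lemma msizeM_leS (p q : mpoly n rat) a b :
  (mmeasure mdeg p <= a.+1)%N -> (mmeasure mdeg q <= b.+1)%N ->
  (mmeasure mdeg (p * q) <= (a + b).+1)%N.
Proof.
have [->|p0] := eqVneq p 0; first by rewrite mul0r mmeasure0.
have [->|q0] := eqVneq q 0; first by rewrite mulr0 mmeasure0.
by rewrite msizeM //; move: (mmeasure _ p) (mmeasure _ q) => x y; lia.
Qed.

(** There are [D.+1 ^ #|K|] products with exponents at most [D], while their degrees grow only
    linearly in [D], so they span a space of dimension of order [D ^ n]. *)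
Lemma mpoly_alg_dep (K : finType) (g : K -> mpoly n rat) : (n < #|K|)%N ->
  exists D (a : {ffun K -> 'I_D.+1} -> rat),
    (exists al, a al != 0) /\ \sum_al a al *: \prod_k g k ^+ al k = 0.
Proof.
move=> nK; pose d := (\max_k mmeasure mdeg (g k))%N.
(* With these values [B.+1 <= D.+1 * C], hence [B.+1 ^ n <= D.+1 ^ n * D < D.+1 ^ n.+1]. *)
pose C := (#|K| * d).+1; pose D := (C ^ n)%N; pose B := (#|K| * D * d)%N.
exists D; apply: (@mpoly_lin_dep B) => [al|]; last first.
  rewrite card_ffun card_ord; apply: (@leq_trans (D.+1 ^ n.+1)); last by rewrite leq_pexp2l.
  apply: (@leq_ltn_trans ((D.+1 * C) ^ n)).
    by case: (n) => // n'; rewrite leq_exp2r // /B /C; nia.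
  by rewrite expnMn expnSr ltn_pmul2l ?expn_gt0.
have Xe (p : mpoly n rat) e : (mmeasure mdeg p <= d)%N ->
    (mmeasure mdeg (p ^+ e) <= (e * d).+1)%N.
  move=> pd; elim: e => [|e IH]; first by rewrite expr0 msize1.
  by rewrite exprS mulSn; apply: msizeM_leS => //; apply: leqW.
apply: (@leq_trans (\sum_(k : K) D * d).+1); last first.
  by rewrite sum_nat_const /B mulnA.
elim/big_rec2: _ => [|k p s _ IH]; first by rewrite msize1.
apply: msizeM_leS => //; apply: leq_trans (Xe _ _ _) _.
  by rewrite /d (bigD1 k) //= leq_maxl.
by rewrite ltnS leq_mul2r -ltnS ltn_ord orbT.
Qed.

End Counting.

(** * Transcendence degree *)

Section Transcendence.
Variables (R : realType) (n m : nat) (z : 'I_n -> R) (f : 'I_m -> R)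
  (g : 'I_m -> mpoly n rat).
Hypotheses (fg : forall i, f i = ratev z (g i))
  (f_ind : forall P, ratev f P = 0 -> P = 0).

(** More polynomials than variables satisfy a relation, which evaluation at [z] turns into one among
    the independent [f]. *)
Lemma alg_ind_leq : (m <= n)%N.
Proof.
rewrite leqNgt; apply/negP => ltnm.
have [|D [a [[al a0]]]] := @mpoly_alg_dep n _ g; first by rewrite card_ord.
move/(congr1 (ratev z)); rewrite rmorph0 rmorph_sum /= => rel.
have := f_ind (P := \sum_al a al *: mpolyX rat (mnm_of_fun al)).
rewrite rmorph_sum /=; have -> : \sum_i ratev f (a i *: mpolyX rat (mnm_of_fun i)) = 0.
  rewrite -[RHS]rel; apply: eq_bigr => be _; rewrite !ratevZ ratev_Xm rmorph_prod.
  by congr (_ * _); apply: eq_bigr => i _; rewrite rmorphXn /= fg mnm_of_funE.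
move=> /(_ erefl)/(congr1 (mcoeff (mnm_of_fun al))); rewrite mcoeff0 raddf_sum /=.
rewrite (bigD1 al) //= mcoeffZ mcoeffX eqxx mulr1 big1 ?addr0 => [/eqP|be ab].
  by rewrite (negPf a0).
by rewrite mcoeffZ mcoeffX (inj_eq (@mnm_of_fun_inj _ _)) (negPf ab) mulr0.
Qed.

(** The [g] and [g0] are [m + 1] polynomials in at most [m] variables. Their relation, sorted by
    powers of [g0], is the desired equation; its coefficients cannot cancel because the monomials
    are distinct. *)
Lemma alg_ind_alg (g0 : mpoly n rat) : (n <= m)%N ->
  exists D (cs : 'I_D.+1 -> mpoly m rat), (exists i, cs i != 0) /\
    \sum_i ratev f (cs i) * ratev z g0 ^+ i = 0.
Proof.
move=> nm; pose G (k : option 'I_m) := if k is Some i then g i else g0.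
have [|D [a [[al a0] rel]]] := @mpoly_alg_dep n _ G.
  by rewrite card_option card_ord.
pose low (be : {ffun option 'I_m -> 'I_D.+1}) := [ffun i => be (Some i)].
exists D, (fun i => \sum_(be : {ffun option 'I_m -> 'I_D.+1} | be None == i)
  a be *: mpolyX rat (mnm_of_fun (low be))); split.
  exists (al None); apply: contraNneq a0 => /(congr1 (mcoeff (mnm_of_fun (low al)))).
  rewrite mcoeff0 raddf_sum /= (bigD1 al) //= mcoeffZ mcoeffX eqxx mulr1 big1.
    by rewrite addr0 => ->.
  move=> be /andP[/eqP b0 ab]; rewrite mcoeffZ mcoeffX (inj_eq (@mnm_of_fun_inj _ _)).
  case: eqP => [h|]; last by rewrite mulr0.
  case/eqP: ab; apply/ffunP => -[i|//].
  by have /ffunP/(_ i) := h; rewrite !ffunE.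
move/(congr1 (ratev z)): rel; rewrite rmorph0 rmorph_sum /= => rel.
rewrite -[RHS]rel (partition_big (fun be : {ffun _ -> _} => be None) predT) //=.
apply: eq_bigr => i _; rewrite rmorph_sum mulr_suml; apply: eq_bigr => be /eqP <-.
rewrite /= !ratevZ -mulrA; congr (_ * _); rewrite ratev_Xm rmorph_prod mulrC.
rewrite (bigD1 None) //= rmorphXn; congr (_ * _).
rewrite (reindex_omap (@Some 'I_m) id) => [|[]//] /=.
by apply: eq_big => [j|j _]; rewrite ?eqxx // rmorphXn /= fg mnm_of_funE ffunE.
Qed.

End Transcendence.

(** * Relative algebraic closure *)

Section AlgebraicClosure.
Variables (R : realType) (I : finType) (x : I -> R).
Implicit Types (S : {set I}) (P Q : mpoly #|I| rat).

(** Involving only the variables in [S], expressed through values so that variables need no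
    renaming. *)
Definition local S P := forall y z : I -> R, {in S, y =1 z} -> mev y P = mev z P.

Lemma local1 S : local S 1.
Proof. by move=> y z _; rewrite !rmorph1. Qed.

Lemma localB S P Q : local S P -> local S Q -> local S (P - Q).
Proof. by move=> lP lQ y z yz; rewrite !mevB (lP y z) ?(lQ y z). Qed.

Lemma localM S P Q : local S P -> local S Q -> local S (P * Q).
Proof. by move=> lP lQ y z yz; rewrite !mevM (lP y z) ?(lQ y z). Qed.

Lemma local_var S i : i \in S -> local S (mvar i).
Proof. by move=> iS y z yz; rewrite !mev_var yz. Qed.

(** The subfield of [R] generated by the [x i] with [i] in [S]. *)
Definition ratfun S : {pred R} := fun u => `[< exists P Q,
  [/\ local S P, local S Q, mev x Q != 0 & u = mev x P / mev x Q] >].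

Lemma ratfunP S u : reflect (exists P Q,
  [/\ local S P, local S Q, mev x Q != 0 & u = mev x P / mev x Q]) (u \in ratfun S).
Proof. exact: asboolP. Qed.

Lemma ratfun_mev S P : local S P -> mev x P \in ratfun S.
Proof.
move=> lP; apply/ratfunP; exists P, 1.
by split=> //; [apply: local1|rewrite rmorph1 oner_neq0|rewrite rmorph1 divr1].
Qed.

Fact ratfun_divring_closed S : divring_closed (ratfun S).
Proof.
split; first by rewrite -(rmorph1 (mev x)); apply/ratfun_mev/local1.
- move=> _ _ /ratfunP[P [Q [lP lQ Q0 ->]]] /ratfunP[P' [Q' [lP' lQ' Q0' ->]]].
  apply/ratfunP; exists (P * Q' - P' * Q), (Q * Q'); split.
  + by apply: localB; apply: localM.
  + exact: localM.
  + by rewrite mevM (mulf_neq0 Q0 Q0').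
  + by rewrite mevB !mevM -mulNr (addf_div _ _ Q0 Q0') mulNr.
move=> _ _ /ratfunP[P [Q [lP lQ Q0 ->]]] /ratfunP[P' [Q' [lP' lQ' Q0' ->]]].
have [P0'|P0'] := eqVneq (mev x P') 0.
  rewrite P0' mul0r invr0 mulr0 -(rmorph0 (mev x)); apply: ratfun_mev.
  by move=> y z _; rewrite !rmorph0.
apply/ratfunP; exists (P * Q'), (Q * P'); split.
+ exact: localM.
+ exact: localM.
+ by rewrite mevM (mulf_neq0 Q0 P0').
+ by rewrite !mevM invf_div mulf_div.
Qed.
HB.instance Definition _ S :=
  GRing.isDivringClosed.Build R (ratfun S) (ratfun_divring_closed S).

Record ratext S := Ratext {ratval : R; _ : ratval \in ratfun S}.
HB.instance Definition _ S := [isSub for @ratval S].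
HB.instance Definition _ S := [Choice of ratext S by <:].
HB.instance Definition _ S := [SubChoice_isSubIntegralDomain of ratext S by <:].
HB.instance Definition _ S := [SubIntegralDomain_isSubField of ratext S by <:].

Definition acl S (u : R) := algebraicOver (\val : ratext S -> R) u.

Lemma aclP S u : acl S u <->
  exists p : {poly R}, [/\ p != 0, root p u & forall i, p`_i \in ratfun S].
Proof.
split=> [[p p0 pu]|[p [p0 pu pS]]].
  exists (map_poly (\val : ratext S -> R) p).
  by rewrite map_poly_eq0 p0; split=> // i; rewrite coef_map; apply: valP.
have pE : map_poly (\val : ratext S -> R) (map_poly (insubd 0) p) = p.
  by apply/polyP => i; rewrite coef_map /= coef_map_id0 ?insubdK //;
    apply: val_inj; rewrite insubdK ?rpred0.
exists (map_poly (insubd 0) p); last by rewrite pE.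
by rewrite -(map_poly_eq0 (\val : {rmorphism ratext S -> R})) pE.
Qed.


Lemma acl_ratfun S u : u \in ratfun S -> acl S u.
Proof. by move=> uS; have := algebraic_id (\val : ratext S -> R) (Ratext uS). Qed.

Lemma aclD S u v : acl S u -> acl S v -> acl S (u + v).
Proof. exact: algebraic_add. Qed.

Lemma aclB S u v : acl S u -> acl S v -> acl S (u - v).
Proof. exact: algebraic_sub. Qed.

Lemma aclM S u v : acl S u -> acl S v -> acl S (u * v).
Proof. exact: algebraic_mul. Qed.

Lemma acl_div S u v : acl S u -> acl S v -> acl S (u / v).
Proof. exact: algebraic_div. Qed.

Lemma aclX S u n : acl S u -> acl S (u ^+ n).
Proof.
move=> uS; elim: n => [|n IH]; first by rewrite expr0; apply: algebraic1.
by rewrite exprS; apply: aclM.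
Qed.

Lemma acl_var S i : i \in S -> acl S (x i).
Proof. by move=> iS; rewrite -(mev_var x i); apply/acl_ratfun/ratfun_mev/local_var. Qed.

Lemma acl_nat S n : acl S n%:R.
Proof. by apply: acl_ratfun; rewrite rpred_nat. Qed.

(** Transitivity of algebraic dependence, by way of integrality, which amounts to the same over a
    field. *)
Lemma acl_root S (p : {poly R}) u :
  p != 0 -> root p u -> (forall i, acl S p`_i) -> acl S u.
Proof.
move=> p0 pu pS; apply/integral_algebraic/(integral_root p0 pu) => _ /(nthP 0)[i _ <-].
by apply/integral_algebraic; apply: pS.
Qed.

Lemma aclS S (T : {set I}) u : S \subset T -> acl S u -> acl T u.
Proof.
move=> /subsetP sST /aclP[p [p0 pu pS]]; apply/aclP; exists p; split=> // i.
have [P [Q [lP lQ Q0 e]]] := ratfunP _ _ (pS i); apply/ratfunP; exists P, Q.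
by split=> // y z yz; [apply: lP|apply: lQ] => k /sST; apply: yz.
Qed.

Lemma ratfun_common_den S (u : nat -> R) n : (forall i, u i \in ratfun S) ->
  exists Q, [/\ local S Q, mev x Q != 0 & forall i, (i < n)%N ->
    exists2 P, local S P & mev x Q * u i = mev x P].
Proof.
move=> uS; elim: n => [|n [Q [lQ Q0 IH]]].
  by exists 1; rewrite rmorph1 oner_neq0; split=> //; apply: local1.
have [P' [Q' [lP' lQ' Q0' ue]]] := ratfunP _ _ (uS n).
exists (Q * Q'); rewrite mevM (mulf_neq0 Q0 Q0'); split; [exact: localM|exact: isT|].
move=> i; rewrite ltnS leq_eqVlt => /predU1P[->|/IH[P lP e]].
  exists (Q * P'); first exact: localM.
  by rewrite ue !mevM -mulrA; congr (_ * _); rewrite [LHS]mulrC (divfK Q0').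
exists (P * Q'); first exact: localM.
by rewrite mevM -e mulrAC.
Qed.

(** Cleared of denominators, an equation for [x j] becomes a polynomial relation [Psi], which is an
    identity by independence. Substituting natural numbers for [x j] then gives [p] too many
    roots. *)
Lemma alg_independent_acl S j : alg_independent x -> j \notin S -> ~ acl S (x j).
Proof.
move=> gx jS /aclP[p [p0 /rootP pxj pS]].
have [Q [lQ Q0 hQ]] := ratfun_common_den (size p) pS.
have /choice[P hP] : forall i : 'I_(size p), exists P,
    local S P /\ mev x Q * p`_i = mev x P.
  by move=> i; have [P lP e] := hQ i (ltn_ord i); exists P.
pose Psi := \sum_i P i * mvar j ^+ i.
have Psi0 : Psi = 0.
  suff /gx : mev x Psi = 0 by [].
  rewrite rmorph_sum /=; transitivity (mev x Q * p.[x j]); last by rewrite pxj mulr0.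
  rewrite horner_coef mulr_sumr; apply: eq_bigr => i _.
  by rewrite rmorphM rmorphXn /= mev_var -(hP i).2 mulrA.
suff: (size p < size p)%N by rewrite ltnn.
rewrite -[X in (X < _)%N](size_iota 0) -(size_map (fun i => i%:R : R)).
apply: max_poly_roots p0 _ _; last first.
  by rewrite map_inj_uniq ?iota_uniq // => a b /eqP; rewrite eqr_nat => /eqP.
apply/allP => _ /mapP[t _ ->]; apply/rootP/(mulfI Q0); rewrite mulr0.
pose y i := if i == j then t%:R else x i.
have := congr1 (mev y) Psi0; rewrite rmorph0 rmorph_sum /= => <-.
rewrite horner_coef mulr_sumr; apply: eq_bigr => i _.
rewrite rmorphM rmorphXn /= mev_var /y eqxx mulrA (hP i).2; congr (_ * _).
by apply: (hP i).1 => k kS; case: eqP => // kj; rewrite -kj kS in jS.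
Qed.

End AlgebraicClosure.

(** * Distances between the neighbours of a vertex *)

Section Tanigawa.
Variables (R : realType) (V : finType).
Implicit Types (c d : V -> 'I_2 -> R) (F : {set {set V}}).

Lemma sqdE c u w : sqd c u w = (c u 0 - c w 0) ^+ 2 + (c u 1 - c w 1) ^+ 2.
Proof. by rewrite /sqd big_ord_recl big_ord1; congr (_ + (c u _ - c w _) ^+ 2); apply: val_inj. Qed.

(** A translation followed by a rotation: in complex terms, multiplication by the conjugate of
    [p0 + i p1] divided by [r]. *)
Lemma normalize d a b : exists d',
  (forall u w, sqd d' u w = sqd d u w) /\ [/\ d' a 0 = 0, d' a 1 = 0 & d' b 1 = 0].
Proof.
pose p0 := d b 0 - d a 0; pose p1 := d b 1 - d a 1.
pose s := p0 ^+ 2 + p1 ^+ 2; pose r := Num.sqrt s.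
have s0 : 0 <= s by rewrite addr_ge0 ?sqr_ge0.
have r2 : r ^+ 2 = s by rewrite sqr_sqrtr.
(* When [d] puts [a] and [b] at the same point, the translation suffices. *)
have [r0|r0] := eqVneq r 0.
  exists (fun u k => d u k - d a k); split.
    by move=> u w; rewrite !sqdE; ring.
  rewrite !subrr; split=> //; apply/eqP; rewrite -sqrf_eq0.
  have : s == 0 by rewrite -r2 r0 expr0n.
  by rewrite paddr_eq0 ?sqr_ge0 // => /andP[].
exists (fun u k => if k == 0 then (p0 * (d u 0 - d a 0) + p1 * (d u 1 - d a 1)) / r
  else (p0 * (d u 1 - d a 1) - p1 * (d u 0 - d a 0)) / r); split=> [u w|].
  rewrite !sqdE /=.
  transitivity (((d u 0 - d w 0) ^+ 2 + (d u 1 - d w 1) ^+ 2) * (s / r ^+ 2)).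
    by rewrite /s; field.
  by rewrite r2 divff ?mulr1 // -r2 expf_neq0.
by split; rewrite /= -/p0 -/p1 ?subrr ?mulr0 ?addr0 ?subr0 ?[p1 * _]mulrC ?subrr mul0r.
Qed.

(** Otherwise [u] would be a root of a nonzero polynomial with algebraic coefficients. *)
Lemma acl_quadratic_const (I : finType) (x : I -> R) S a0 a1 a2 u :
  acl x S a0 -> acl x S a1 -> acl x S a2 -> ~ acl x S u ->
  a0 + a1 * u + a2 * u ^+ 2 = 0 -> a0 = 0.
Proof.
move=> A0 A1 A2 nu e; apply: contra_notP nu => /eqP a00.
pose p : {poly R} := a0%:P + a1 *: 'X + a2 *: 'X^2.
have pE i : p`_i = a0 * (i == 0%N)%:R + a1 * (i == 1%N)%:R + a2 * (i == 2%N)%:R.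
  rewrite !(coefD, coefZ, coefC, coefX, coefXn).
  by case: i => [|[|[|i]]]; rewrite /= ?mulr0 ?mulr1.
apply: (@acl_root _ _ _ _ p).
- by apply: contraNneq a00 => p0; have := pE 0%N; rewrite p0 coef0 mulr1 !mulr0 !addr0 => <-.
- by apply/rootP; rewrite -[RHS]e /p !hornerE.
- by move=> i; rewrite pE; do ![apply: aclD]; apply: aclM => //; apply: acl_nat.
Qed.

Section Step.
Variables (c d : V -> 'I_2 -> R) (F : {set {set V}}) (v a b e : V).
Hypotheses (gc : alg_independent (coords c)) (indF : indep c F)
  (Fv : forall f, f \in F -> v \notin f) (cF : (#|F| + 3 = 2 * #|V|.-1)%N)
  (lenF : forall f, f \in F -> sqlen c f = sqlen d f)
  (av : a != v) (bv : b != v) (ev : e != v) (ab : a != b) (ae : a != e) (be : b != e)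
  (da0 : d a 0 = 0) (da1 : d a 1 = 0) (db1 : d b 1 = 0).

Let S1 := [set vi : V * 'I_2 | vi.1 != v].
(** Only nonzero coordinates of [d] serve as variables, so the pinned ones are not counted. *)
Let Zs := [set vi in S1 | d vi.1 vi.2 != 0].
Let z (i : 'I_#|Zs|) := d (enum_val i).1 (enum_val i).2.
Let dz u k : mpoly #|Zs| rat :=
  \sum_(i < #|Zs|) (enum_val i == (u, k))%:R * mpolyX rat (mnm1 i).
Let f (i : 'I_#|F|) := sqlen c (enum_val i).

Let zE u k : u != v -> ratev z (dz u k) = d u k.
Proof.
move=> uv; rewrite /dz rmorph_sum /=.
have [uZ|uZ] := boolP ((u, k) \in Zs).
  rewrite (bigD1 (enum_rank_in uZ (u, k))) //= rmorphM rmorph_nat /= ratev_X.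
  rewrite enum_rankK_in // eqxx mul1r /z enum_rankK_in // big1 ?addr0 // => i.
  move=> /eqP ni; rewrite rmorphM rmorph_nat; case: eqP => [h|]; last by rewrite mul0r.
  by case: ni; apply: enum_val_inj; rewrite enum_rankK_in.
rewrite big1; first by move: uZ; rewrite !inE uv negbK => /eqP.
move=> i _; rewrite rmorphM rmorph_nat; case: eqP => [h|]; last by rewrite mul0r.
by rewrite -h enum_valP in uZ.
Qed.

Let fg i : f i = ratev z (sqlen dz (enum_val i)).
Proof.
rewrite /f lenF ?enum_valP // sqlen_rmorph; apply: eq_sqlen => u w uw.
have := Fv (enum_valP i); rewrite -uw !inE negb_or ![v == _]eq_sym => /andP[uv wv].
by apply: eq_bigr => k _; rewrite /= !zE.
Qed.

Let f_ind P : ratev f P = 0 -> P = 0.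
Proof. exact: sqlen_alg_independent gc indF P. Qed.

Let pinned : {set V * 'I_2} := [set (a, 0); (a, 1); (b, 1)].

Let card_free : #|S1 :\: pinned| = #|F|.
Proof.
have cS1 : #|S1| = (2 * #|V|.-1)%N.
  have -> : S1 = setX [set~ v] setT by apply/setP => -[u k]; rewrite !inE andbT.
  by rewrite cardsX cardsC1 cardsT card_ord mulnC.
have sub3 : pinned \subset S1.
  by apply/subsetP => -[u k]; rewrite !inE => /orP[/orP[]|] /eqP[-> _].
have c3 : #|pinned| = 3%N.
  rewrite /pinned -setUA cardsU1 cards2 !inE -!pair_eqE /= !eqxx /=.
  by rewrite (negPf ab).
by rewrite cardsD (setIidPr sub3) c3 cS1 -cF addnK.
Qed.

(* Otherwise the edge lengths would be polynomials in fewer than #|F| numbers. *)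
Let ZsE vi : (vi \in Zs) = (vi \in S1 :\: pinned).
Proof.
have sub : Zs \subset S1 :\: pinned.
  apply/subsetP => -[u k]; rewrite !inE /= => /andP[-> dn]; rewrite andbT.
  by apply: contraNN dn => /orP[/orP[]|] /eqP[-> ->]; rewrite ?da0 ?da1 ?db1.
suff /eqP -> : Zs == S1 :\: pinned by [].
by rewrite eqEcard sub card_free; apply: alg_ind_leq fg f_ind.
Qed.

(** There are now as many variables as independent lengths, so the coordinates of [d] are algebraic
    over the lengths, which are polynomials in the coordinates of [c] away from [v]. *)
Let acl_d u k : u != v -> acl (coords c) S1 (d u k).
Proof.
move=> uv; have cZ : (#|Zs| <= #|F|)%N.
  by rewrite -card_free (eq_card ZsE).
have [D [cs [[i0 ci0] rel]]] := alg_ind_alg fg (dz u k) cZ.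
rewrite zE // in rel.
apply: (@acl_root _ _ _ _ (\poly_(i < D.+1) ratev f (cs (inord i)))).
- apply: contraNneq ci0 => /polyP/(_ i0); rewrite coef_poly ltn_ord coef0 inord_val.
  by move/f_ind ->.
- apply/rootP; rewrite horner_poly -[RHS]rel; apply: eq_bigr => i _.
  by rewrite inord_val.
move=> i; rewrite coef_poly; case: ifP => _; last exact: (acl_nat _ _ 0).
pose g (j : 'I_#|F|) : mpoly #|{: V * 'I_2}| rat :=
  sqlen (fun u k => mvar (u, k)) (enum_val j).
have gE (y : V * 'I_2 -> R) j : mev y (g j) = sqlen (fun u k => y (u, k)) (enum_val j).
  by rewrite /g sqlen_rmorph; apply: eq_sqlen => u' w _;
    apply: eq_bigr => k' _; rewrite /= !mev_var.
have mE (y : V * 'I_2 -> R) P : mev y (msubst g P) =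
    ratev (fun j => sqlen (fun u k => y (u, k)) (enum_val j)) P.
  by rewrite /mev ratev_msubst; apply: mpoly.meval_eq => j; exact: gE.
have -> : ratev f (cs (inord i)) = mev (coords c) (msubst g (cs (inord i))).
  by rewrite mE.
apply/acl_ratfun/ratfun_mev => y y' yy'; rewrite !mE.
apply: mpoly.meval_eq => j; apply: eq_sqlen => u' w uw.
have := Fv (enum_valP j); rewrite -uw !inE negb_or ![v == _]eq_sym => /andP[uv' wv].
by apply: eq_bigr => k' _; rewrite !yy' // inE.
Qed.

Lemma anchored_distance : sqd c v a = sqd d v a -> sqd c v b = sqd d v b ->
  sqd c v e = sqd d v e -> sqd c a b = sqd d a b.
Proof.
(* By [ZsE] every coordinate that is not pinned is nonzero, which permits the divisions by [s] and
   [r] below. *)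
have db0 : d b 0 != 0.
  have : (b, 0) \in Zs by rewrite ZsE !inE -!pair_eqE /= eq_sym (negPf ab) /= andbF.
  by rewrite !inE => /andP[].
have de1 : d e 1 != 0.
  have : (e, 1) \in Zs.
    by rewrite ZsE !inE -!pair_eqE /= (eq_sym e a) (eq_sym e b) (negPf ae) (negPf be) ev.
  by rewrite !inE => /andP[].
rewrite !sqdE da0 da1 db1 !subr0 !sub0r => eq1 eq2 eq3.
(* The coordinates of [v] are eliminated in turn: [eta] is transcendental over [S2], then [xi] over
   [S1]. *)
pose S2 := (v, 0) |: S1.
have acl_c u k : u != v -> acl (coords c) S1 (c u k).
  by move=> uv; rewrite -[c u k]/(coords c (u, k)); apply: acl_var; rewrite inE.
pose xi := c v 0 - c a 0; pose eta := c v 1 - c a 1.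
have S12 : S1 \subset S2 by apply: subsetUr.
have nxi : ~ acl (coords c) S1 xi.
  move=> h; have : acl (coords c) S1 (coords c (v, 0)).
    by rewrite -[coords c _](subrK (c a 0)); apply: aclD h _; apply: acl_c.
  by apply: alg_independent_acl; rewrite // inE eqxx.
have axi : acl (coords c) S2 xi.
  apply: aclB; last by apply: aclS S12 _; apply: acl_c.
  by rewrite -[c v 0]/(coords c (v, 0)); apply: acl_var; rewrite !inE eqxx.
have neta : ~ acl (coords c) S2 eta.
  move=> h; have : acl (coords c) S2 (coords c (v, 1)).
    rewrite -[coords c _](subrK (c a 1)); apply: aclD h _.
    by apply: aclS S12 _; apply: acl_c.
  by apply: alg_independent_acl; rewrite // !inE eqxx -!pair_eqE /= andbF.
pose s := d b 0; pose t := d e 0; pose r := d e 1.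
pose b0 := c b 0 - c a 0; pose b1 := c b 1 - c a 1.
pose g0 := c e 0 - c a 0; pose g1 := c e 1 - c a 1.
(* The coefficients of [d v 0] (the [u]) and [d v 1] (the [w]) as affine functions of [xi] and
   [eta], obtained by solving [lin1] and [lin2]. *)
pose u1 := b0 / s; pose u2 := b1 / s; pose u0 := (s ^+ 2 - (b0 ^+ 2 + b1 ^+ 2)) / (2%:R * s).
pose w1 := (g0 - t * u1) / r; pose w2 := (g1 - t * u2) / r.
pose w0 := ((t ^+ 2 + r ^+ 2 - (g0 ^+ 2 + g1 ^+ 2)) / 2%:R - t * u0) / r.
have as_ : acl (coords c) S1 s by apply: acl_d.
have at_ : acl (coords c) S1 t by apply: acl_d.
have ar : acl (coords c) S1 r by apply: acl_d.
have [ab0 ab1 ag0 ag1] : [/\ acl (coords c) S1 b0, acl (coords c) S1 b1,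
    acl (coords c) S1 g0 & acl (coords c) S1 g1].
  by split; apply: aclB; apply: acl_c.
have n2 := acl_nat (coords c) S1 2.
have au0 : acl (coords c) S1 u0.
  by apply: acl_div; [apply: aclB; [exact: aclX|apply: aclD; exact: aclX]|exact: aclM].
have au1 : acl (coords c) S1 u1 by apply: acl_div.
have au2 : acl (coords c) S1 u2 by apply: acl_div.
have aw1 : acl (coords c) S1 w1 by apply: acl_div; [apply: aclB; [|exact: aclM]|].
have aw2 : acl (coords c) S1 w2 by apply: acl_div; [apply: aclB; [|exact: aclM]|].
have aw0 : acl (coords c) S1 w0.
  apply: acl_div => //; apply: aclB; last exact: aclM.
  by apply: acl_div => //; apply: aclB; apply: aclD; exact: aclX.
have s0 : s != 0 by []; have r0 : r != 0 by [].
(* Subtracting [eq2], and in [lin2] [eq3], from [eq1] cancels the squares of the coordinates of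
   [v]. *)
have lin1 : 2%:R * s * d v 0 = 2%:R * b0 * xi + 2%:R * b1 * eta - (b0 ^+ 2 + b1 ^+ 2) + s ^+ 2.
  by rewrite /s /b0 /b1 /xi /eta; lra.
have lin2 : 2%:R * t * d v 0 + 2%:R * r * d v 1 =
    2%:R * g0 * xi + 2%:R * g1 * eta - (g0 ^+ 2 + g1 ^+ 2) + t ^+ 2 + r ^+ 2.
  by rewrite /t /r /g0 /g1 /xi /eta; lra.
have X0 : d v 0 = u1 * xi + u2 * eta + u0.
  transitivity (2%:R * s * d v 0 / (2%:R * s)); first by field.
  by rewrite lin1 /u1 /u2 /u0; field.
have Y0 : d v 1 = w1 * xi + w2 * eta + w0.
  transitivity ((2%:R * t * d v 0 + 2%:R * r * d v 1 - 2%:R * t * d v 0) / (2%:R * r)).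
    by field.
  by rewrite lin2 X0 /w1 /w2 /w0; field.
(* The equation [eq1] as a quadratic in [eta], with a quadratic in [xi] as constant term. *)
have Phi : (- (u0 ^+ 2 + w0 ^+ 2) + - (2%:R * (u0 * u1 + w0 * w1)) * xi +
    (1 - u1 ^+ 2 - w1 ^+ 2) * xi ^+ 2)
  + (- 2%:R * ((u1 * u2 + w1 * w2) * xi + (u0 * u2 + w0 * w2))) * eta
  + (1 - u2 ^+ 2 - w2 ^+ 2) * eta ^+ 2 = 0.
  transitivity (xi ^+ 2 + eta ^+ 2 - (d v 0 ^+ 2 + d v 1 ^+ 2)).
    by rewrite X0 Y0; ring.
  by rewrite -eq1 /xi /eta; ring.
have a1 := acl_nat (coords c) S1 1.
have axiS u : acl (coords c) S1 u -> acl (coords c) S2 u by apply: aclS.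
have A1 : acl (coords c) S1 (- (u0 ^+ 2 + w0 ^+ 2)).
  by rewrite -sub0r; apply: aclB; [exact: (acl_nat _ _ 0)|apply: aclD; exact: aclX].
have A2 : acl (coords c) S1 (- (2%:R * (u0 * u1 + w0 * w1))).
  rewrite -sub0r; apply: aclB; first exact: (acl_nat _ _ 0).
  by apply: aclM => //; apply: aclD; apply: aclM.
have A3 : acl (coords c) S1 (1 - u1 ^+ 2 - w1 ^+ 2).
  by apply: aclB; [apply: aclB => //|]; exact: aclX.
have Q1 : - (u0 ^+ 2 + w0 ^+ 2) + - (2%:R * (u0 * u1 + w0 * w1)) * xi +
    (1 - u1 ^+ 2 - w1 ^+ 2) * xi ^+ 2 = 0.
  apply: (acl_quadratic_const (x := coords c) (S := S2) (u := eta)) neta Phi.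
  - apply: aclD; first by apply: aclD; [exact: axiS|apply: aclM => //; exact: axiS].
    by apply: aclM; [exact: axiS|exact: aclX].
  - apply: aclM; first by rewrite -sub0r; apply: aclB; apply: axiS => //; exact: (acl_nat _ _ 0).
    apply: aclD; first by apply: aclM => //; apply: axiS; apply: aclD; apply: aclM.
    by apply: axiS; apply: aclD; apply: aclM.
  - by apply: axiS; apply: aclB; [apply: aclB => //|]; exact: aclX.
(* A sum of two squares vanishes, so [u0 = 0], and this says that [s ^+ 2 = b0 ^+ 2 + b1 ^+ 2]. *)
have /eqP := acl_quadratic_const A1 A2 A3 nxi Q1.
rewrite oppr_eq0 paddr_eq0 ?sqr_ge0 // sqrf_eq0 => /andP[/eqP u00 _].
have : u0 * (2%:R * s) = 0 by rewrite u00 mul0r.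
rewrite /u0 divfK ?mulf_neq0 ?pnatr_eq0 // => /eqP; rewrite subr_eq0 => /eqP.
by rewrite /b0 /b1 /s => h; lra.
Qed.

End Step.
End Tanigawa.

(** * Vertex-redundant rigidity *)

Section VertexRedundant.
Variables (R : realType) (V : finType).
Implicit Types (c d : V -> 'I_2 -> R) (F : {set {set V}}) (G : sgraph V).

Lemma sqdC c u w : sqd c u w = sqd c w u.
Proof. by apply: eq_bigr => k _; rewrite -sqrrN opprB. Qed.

Lemma sqd_nbrs c d F v a b e : alg_independent (coords c) -> sparse F ->
  (forall f, f \in F -> v \notin f) -> (#|F| + 3 = 2 * #|V|.-1)%N ->
  (forall u w, [set u; w] \in F -> sqd c u w = sqd d u w) ->
  a != v -> b != v -> e != v -> a != b -> a != e -> b != e ->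
  sqd c v a = sqd d v a -> sqd c v b = sqd d v b -> sqd c v e = sqd d v e ->
  sqd c a b = sqd d a b.
Proof.
move=> gc spF Fv cF lenF av bv ev ab ae be ea eb ee.
have [d' [dd' [da0 da1 db1]]] := normalize d a b.
rewrite -dd'.
apply: (anchored_distance gc (laman gc spF) Fv cF _ av bv ev ab ae be); rewrite ?dd' //.
by move=> f fF; apply: eq_sqlen => u w uw; rewrite dd'; apply: lenF; rewrite uw.
Qed.

Definition gedges G : {set {set V}} :=
  [set [set u.1; u.2] | u in [set u : V * V | G u.1 u.2]].

Lemma mem_gedges G u w : ([set u; w] \in gedges G) = G u w.
Proof.
apply/imsetP/idP => [[[x y]]|uw]; last by exists (u, w); rewrite ?inE.
rewrite inE /= => xy e; have xu : x \in [set u; w] by rewrite e set21.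
have yu : y \in [set u; w] by rewrite e set22.
have nxy : x != y by apply: contraTneq xy => ->; rewrite adj_irrefl.
move: xu yu; rewrite !inE => /orP[]/eqP xE /orP[]/eqP yE.
- by rewrite xE yE eqxx in nxy.
- by rewrite -xE -yE.
- by rewrite adj_sym -xE -yE.
- by rewrite xE yE eqxx in nxy.
Qed.

Lemma globally_rigid_coords c d G : alg_independent (coords c) -> connected G ->
  (forall v, 3 <= #|[set w | G v w]|)%N ->
  (forall v, exists F, [/\ sparse F, F \subset gedges G,
     forall f, f \in F -> v \notin f & (#|F| + 3 = 2 * #|V|.-1)%N]) ->
  (forall u w, G u w -> sqd c u w = sqd d u w) ->
  forall u w, sqd c u w = sqd d u w.
Proof.
move=> gc conG deg rig eqG u w.
have refl x : sqd c x x = sqd d x x.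
  by rewrite !sqdE !subrr.
(* Neither [x] nor [y] has to be adjacent to [v]. Only the third anchor [e] is a true neighbour, and
   degree three provides one apart from [x] and [y]. *)
have trans x v y : sqd c x v = sqd d x v -> sqd c v y = sqd d v y -> sqd c x y = sqd d x y.
  have [->//|xv] := eqVneq x v; have [<-//|yv] := eqVneq y v.
  have [<-//|xy] := eqVneq x y; rewrite ![_ x v]sqdC => ex ey.
  have [F [spF sFG Fv cF]] := rig v.
  have [e ve eN] : exists2 e, G v e & e \notin [set x; y].
    have : (0 < #|[set w | G v w] :\: [set x; y]|)%N.
      rewrite cardsD subn_gt0; apply: leq_trans (deg v).
      apply: leq_ltn_trans (subset_leq_card (subsetIr _ _)) _.
      by rewrite cards2; case: (x != y).
    by case/card_gt0P => e; rewrite in_setD [X in _ && X]inE => /andP[]; exists e.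
  move: eN; rewrite !inE negb_or => /andP[ex' ey'].
  apply: (sqd_nbrs gc spF Fv cF _ xv yv _ xy _ _ ex ey (eqG _ _ ve)).
  - by move=> s t stF; apply: eqG; rewrite -mem_gedges (subsetP sFG).
  - by apply: contraTneq ve => ->; rewrite adj_irrefl.
  - by rewrite eq_sym.
  - by rewrite eq_sym.
have /connectP[p] := conG u w; elim: p u => [|x p IH] u /=; first by move=> _ ->.
by case/andP => ux xp wE; apply: (trans _ x); [apply: eqG|apply: IH].
Qed.

End VertexRedundant.

(** * Existence of generic points *)

Lemma poly_roots_seq (R : realType) (p : {poly R}) :
  p != 0 -> exists r : seq R, forall t, root p t -> t \in r.
Proof.
have [n] := ubnP (size p); elim: n p => // n IH p /ltnSE lepn p0.
have [[a /factor_theorem[q pE]]|noroot] := pselect (exists a, root p a); last first.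
  by exists [::] => t pt; case: noroot; exists t.
have q0 : q != 0 by apply: contraNneq p0 => q0; rewrite pE q0 mul0r.
have [|r hr] := IH q _ q0.
  by move: lepn; rewrite pE size_Mmonic ?monicXsubC // size_XsubC addn2.
exists (a :: r) => t; rewrite pE rootM root_XsubC in_cons.
by case/orP => [/hr->|->]; rewrite ?orbT.
Qed.

Section CountableNonroot.
Import classical_sets cardinality constructive_ereal lebesgue_measure.

(** The roots form a countable set, of Lebesgue measure zero, which cannot contain the unit
    interval. *)
Lemma countable_nonroot (R : realType) (p : nat -> {poly R}) :
  (forall k, p k != 0) -> exists t, forall k, ~~ root (p k) t.
Proof.
move=> p0; pose Z := (\bigcup_k [set t | root (p k) t])%classic.
have cZ : countable Z.
  apply: bigcup_countable => [|k _]; first exact: countableP.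
  apply: finite_set_countable; have [r hr] := poly_roots_seq (p0 k).
  apply: (sub_finite_set (B := [set` r]%classic)); last exact: finite_seq.
  by move=> t /hr.
have [[t Zt]|h] := pselect (exists t, ~ Z t).
  by exists t => k; apply/negP => h; apply: Zt; exists k.
have sub : (`[(0 : R), 1] `<=` Z)%classic.
  by move=> t _; apply: contrapT => Zt; apply: h; exists t.
have := countable_lebesgue_measure0 (sub_countable (subset_card_le sub) cZ).
by rewrite lebesgue_measure_itv /= lte_fin ltr01 sube0 => /eqP; rewrite onee_eq0.
Qed.

End CountableNonroot.

Section Extension.
Variables (R : realType) (n : nat).

Definition extend (x : 'I_n -> R) (t : R) (i : 'I_n.+1) : R :=
  if unlift ord_max i is Some j then x j else t.

Lemma extend_max x t : extend x t ord_max = t.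
Proof. by rewrite /extend unlift_none. Qed.

Lemma extend_widen x t (i : 'I_n) : extend x t (widen_ord (leqnSn n) i) = x i.
Proof.
rewrite /extend; have -> : widen_ord (leqnSn n) i = lift ord_max i.
  by apply: ord_inj; rewrite lift_max.
by rewrite liftK.
Qed.

Lemma meval_extend (P : mpoly n.+1 R) x t :
  meval (extend x t) P = (map_poly (meval x) (muni P)).[t].
Proof.
rewrite muniE mevalE rmorph_sum horner_sum; apply: eq_bigr => m _ /=.
rewrite big_ord_recr /= extend_max.
rewrite -!mul_polyC !rmorphM /= !map_polyC map_polyXn /= !hornerE.
rewrite mevalZ mevalX; congr (_ * _ * _); apply: eq_bigr => i _.
by rewrite extend_widen mnmE.
Qed.

(** Splitting off the last variable keeps distinct monomials distinct, so the leading one is not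
    cancelled. *)
Lemma muni_neq0 (P : mpoly n.+1 R) : P != 0 -> muni P != 0.
Proof.
move=> P0; have mP := mlead_supp P0; move: (mlead P) mP => m mP.
pose low (k : multinom n.+1) := Multinom [tuple k (widen_ord (leqnSn n) i) | i < n].
apply/eqP => /polyP/(_ (m ord_max))/mpolyP/(_ (low m)); rewrite coef0 mcoeff0 muniE.
rewrite coef_sum raddf_sum /= (bigD1_seq m) ?msupp_uniq //= !coefZ coefXn eqxx mulr1.
rewrite mcoeffZ mcoeffX eqxx mulr1 big1 ?addr0 => [/eqP|k km].
  by rewrite mcoeff_eq0 mP.
rewrite !coefZ coefXn; case: eqP => [e|_]; last by rewrite mulr0 mcoeff0.
rewrite mulr1 mcoeffZ mcoeffX; case: eqP => [h|]; last by rewrite mulr0.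
case/eqP: km; apply/mnmP => i; case: (unliftP ord_max i) => [j ->|-> //].
have := congr1 (fun z : multinom n => z j) h; rewrite !mnmE.
have -> : widen_ord (leqnSn n) j = lift ord_max j.
  by apply: ord_inj; rewrite lift_max.
by [].
Qed.

End Extension.

(** Induction on the variables: the first coordinates keep all leading coefficients in the last
    variable nonzero, then the last coordinate avoids countably many roots. *)
Lemma countable_meval_neq0 (R : realType) n (P : nat -> mpoly n R) :
  (forall k, P k != 0) -> exists x : 'I_n -> R, forall k, meval x (P k) != 0.
Proof.
elim: n P => [|n IH] P P0.
  exists (fun=> 0) => k; move: (P0 k); rewrite [P k]nvar0_mpolyC mevalC.
  by apply: contraNneq => ->; rewrite mpolyC0.
have [|x hx] := IH (fun k => lead_coef (muni (P k))).
  by move=> k; rewrite lead_coef_eq0 muni_neq0.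
have [|t ht] := @countable_nonroot R (fun k => map_poly (meval x) (muni (P k))).
  move=> k; apply: contra (hx k) => /eqP/polyP/(_ (size (muni (P k))).-1).
  by rewrite coef_map coef0 => /eqP.
by exists (extend x t) => k; rewrite meval_extend; apply: ht.
Qed.

(** Rational polynomials are countable, being coded by lists of coefficients and exponents. Codes
    without a nonzero polynomial are given the polynomial 1. *)
Lemma exists_alg_independent (R : realType) (I : finType) :
  exists x : I -> R, alg_independent x.
Proof.
pose N := #|I|.
pose dec (s : seq (rat * multinom N)) : mpoly N rat := \sum_(cm <- s) cm.1 *: mpolyX rat cm.2.
pose Q k : mpoly N R := if @unpickle (seq (rat * multinom N)) k is Some s
  then map_mpoly ratr (dec s) else 1.
have [k|x hx] := @countable_meval_neq0 R N (fun k => if Q k == 0 then 1 else Q k).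
  by case: ifPn => //; rewrite oner_neq0.
exists (fun i => x (enum_rank i)) => P P0; apply/eqP; apply: contraT => nP.
pose s := [seq (mcoeff m P, m) | m <- msupp P].
have := hx (pickle s); rewrite /Q pickleK.
have -> : dec s = P by rewrite /dec big_map -mpolyE.
have nP' : map_mpoly (ratr : rat -> R) P != 0.
  apply: contra nP => /eqP/mpolyP h; apply/eqP/mpolyP => m.
  apply: (fmorph_inj (ratr : {rmorphism rat -> R})).
  by have := h m; rewrite mcoeff_map_mpoly !mcoeff0 rmorph0.
rewrite (negPf nP').
have -> : meval x (map_mpoly ratr P) = 0.
  by rewrite -[RHS]P0; apply: mpoly.meval_eq => i; rewrite enum_valK.
by rewrite eqxx.
Qed.

(** * The mixing inequality *)

Section SymmetricPsd.
Import complex.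

(** Over the complex extension [B] is unitarily diagonalisable. Its eigenvalues are real, hence
    eigenvalues of [B] over [R], and the form becomes a sum of squared moduli weighted by them. *)
Lemma symmetric_psd (R : rcfType) n (B : 'M[R]_n) :
  B^T = B -> (forall a, eigenvalue B a -> 0 <= a) ->
  forall x : 'rV_n, 0 <= (x *m B *m x^T) 0 0.
Proof.
move=> symB posB x; pose C := complex R.
pose toC := real_complex R : {rmorphism R -> C}.
have toC_real a : toC a \is Num.real by rewrite complex_real.
pose BC := map_mx toC B.
have symBC : BC^T = BC by rewrite /BC matrix.map_trmx symB.
have realBC : BC \is a mxOver Num.real.
  by apply/mxOverP => i j; rewrite mxE.
have hermBC : BC \is hermsymmx.
  apply: realsym_hermsym => //; apply/is_hermitianmxP.
  by rewrite expr0 scale1r map_mx_id.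
have /orthomx_spectralP BE := hermitian_normalmx hermBC.
have dreal := hermitian_spectral_diag_real hermBC.
set P := spectralmx BC in BE *; set d := spectral_diag BC in BE dreal *.
have Punit : P \in unitmx := spectral_unit BC.
have Pinv : invmx P = map_mx Num.conj P^T.
  by rewrite invmx_unitary ?spectral_unitarymx.
have d_ge0 i : 0 <= d 0 i.
  have di : d 0 i \is Num.real by apply: (mxOverP dreal).
  have : eigenvalue BC (d 0 i).
    apply/eigenvalueP; exists (row i P).
      rewrite {1}BE !mulmxA -row_mul mulmxV // rowE mulmx1 -rowE.
      by rewrite row_diag_mx -scalemxAl -rowE.
    apply: contraTneq Punit => r0; apply/negP => Pu.
    have := mulmxV Pu => /(congr1 (row i)); rewrite row_mul r0 mul0mx row1.
    by move/rowP/(_ i); rewrite !mxE !eqxx => /esym/eqP; rewrite oner_eq0.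
  rewrite -(RRe_real di) eigenvalue_root_char -[_%:C%C]/(toC _) -map_char_poly fmorph_root.
  rewrite -eigenvalue_root_char => /posB.
  by rewrite -lecR.
pose y := map_mx toC x *m map_mx Num.conj P^T.
have key : toC ((x *m B *m x^T) 0 0) = \sum_i d 0 i * (`|y 0 i| ^+ 2).
  have -> : toC ((x *m B *m x^T) 0 0) =
      (map_mx toC x *m BC *m (map_mx toC x)^T) 0 0.
    by rewrite matrix.map_trmx -!map_mxM [RHS]mxE.
  have yc : P *m (map_mx toC x)^T = (map_mx Num.conj y)^T.
    apply: trmx_inj; rewrite trmxK trmx_mul trmxK /y map_mxM -!map_mx_comp.
    congr (_ *m _); apply/matrixP => i j; rewrite [LHS]mxE [RHS]mxE /=.
      by apply/esym/CrealP/toC_real.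
    by rewrite [in RHS]mxE conjCK.
  rewrite {1}BE Pinv !mulmxA -/y -[X in (X : 'M__) 0 0]mulmxA yc mxE.
  by apply: eq_bigr => i _; rewrite mul_mx_diag !mxE normCK; ring.
rewrite -lecR -[(_)%:C%C in X in _ <= X]/(toC _) key sumr_ge0 // => i _.
by rewrite mulr_ge0 // exprn_ge0.
Qed.

End SymmetricPsd.

Section Mixing.
Variables (R : realType) (V : finType) (G : sgraph V) (k : nat) (lam : R).
Hypotheses (conG : connected G) (regG : regular G k) (lam0 : 0 <= lam)
  (n0 : (0 < #|V|)%N)
  (spec : forall a : R, eigenvalue (adjmx R G) a -> a != k%:R -> a != - k%:R -> `|a| <= lam).

Local Notation n := #|V|.
Local Notation A := (adjmx R G).
(** The multiple of the all-ones matrix is chosen to put the all-ones vector in the kernel. *)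
Let B : 'M[R]_n := lam%:M - A + ((k%:R - lam) / n%:R) *: const_mx 1.

Let nR0 : n%:R != 0 :> R.
Proof. by rewrite pnatr_eq0 -lt0n. Qed.

Lemma adjmx_sym : A^T = A.
Proof. by apply/matrixP => i j; rewrite !mxE adj_sym. Qed.

Lemma adjmx_row_sum i : \sum_j A i j = k%:R.
Proof.
under eq_bigr do rewrite mxE.
rewrite -(big_enum_val (fun w => (G (enum_val i) w)%:R)) /= -natr_sum -(regG (enum_val i)).
by rewrite -sum1dep_card [X in _ = X%:R]big_mkcond.
Qed.

(** The sum of [A i j * (v 0 i - v 0 j) ^+ 2] vanishes, so [v] is constant along edges, and [G] is
    connected. *)
Lemma eigenvector_top (v : 'rV[R]_n) : v *m A = k%:R *: v -> forall i j, v 0 i = v 0 j.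
Proof.
move=> vA.
have sq : \sum_i \sum_j A i j * (v 0 i - v 0 j) ^+ 2 = 0.
  have e1 : \sum_i \sum_j A i j * v 0 i ^+ 2 = k%:R * \sum_i v 0 i ^+ 2.
    by rewrite mulr_sumr; apply: eq_bigr => i _; rewrite -mulr_suml adjmx_row_sum.
  have e2 : \sum_i \sum_j A i j * v 0 j ^+ 2 = k%:R * \sum_i v 0 i ^+ 2.
    rewrite exchange_big -e1; apply: eq_bigr => j _; apply: eq_bigr => i _.
    by rewrite -{1}adjmx_sym mxE.
  have e3 : \sum_i \sum_j A i j * (v 0 i * v 0 j) = k%:R * \sum_i v 0 i ^+ 2.
    rewrite exchange_big mulr_sumr; apply: eq_bigr => j _ /=.
    have /rowP/(_ j) := vA; rewrite !mxE expr2 mulrA => <-; rewrite mulr_suml.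
    by apply: eq_bigr => i _; rewrite mulrA [A i j * _]mulrC.
  transitivity (\sum_i \sum_j (A i j * v 0 i ^+ 2 + A i j * v 0 j ^+ 2 -
    2%:R * (A i j * (v 0 i * v 0 j)))).
    by apply: eq_bigr => i _; apply: eq_bigr => j _; ring.
  under eq_bigr do rewrite !big_split /= sumrN -mulr_sumr.
  rewrite !big_split /= sumrN -mulr_sumr e1 e2 e3; ring.
have edge u w : G u w -> v 0 (enum_rank u) = v 0 (enum_rank w).
  move=> uw; move: sq => /psumr_eq0P sq.
  have pos i j : 0 <= A i j * (v 0 i - v 0 j) ^+ 2.
    by rewrite mulr_ge0 ?sqr_ge0 // mxE ler0n.
  have := sq (fun i _ => sumr_ge0 _ (fun j _ => pos i j)) (enum_rank u) isT.
  move=> /psumr_eq0P h; have := h (fun j _ => pos _ j) (enum_rank w) isT.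
  rewrite mxE !enum_rankK uw mul1r => /eqP.
  by rewrite sqrf_eq0 subr_eq0 => /eqP.
move=> i j; rewrite -(enum_valK i) -(enum_valK j).
have /connectP[p] := conG (enum_val i) (enum_val j).
elim: p (enum_val i) => [|w p IH] u /=; first by move=> _ ->.
by case/andP => /edge -> pw e; apply: IH.
Qed.

(** For [a] nonzero the coordinates of an eigenvector sum to zero, so it is an eigenvector of [A]
    for [lam - a]. This value is not [k], whose eigenvectors are constant. *)
Lemma mixing_psd (a : R) : eigenvalue B a -> 0 <= a.
Proof.
case/eigenvalueP => v vB v0.
have B1 : B *m const_mx 1 = 0 :> 'cV_n.
  apply/matrixP => i j; rewrite mxE [RHS]mxE.
  transitivity (\sum_l (lam *+ (i == l) - A i l + (k%:R - lam) / n%:R)).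
    by apply: eq_bigr => l _; rewrite [B]lock !mxE -lock !mxE !mulr1.
  rewrite !big_split /= sumrN adjmx_row_sum sumr_const card_ord.
  rewrite (bigD1 i) //= eqxx big1 ?addr0 => [|l /negPf li]; last by rewrite eq_sym li.
  by rewrite mulr1n -[X in _ + X = _]mulr_natr divfK //; ring.
have sumv : a * \sum_i v 0 i = 0.
  have := congr1 (fun x : 'rV_n => (x *m (const_mx 1 : 'cV_n)) 0 0) vB.
  rewrite -mulmxA B1 mulmx0 -scalemxAl !mxE => /esym.
  by under eq_bigr do rewrite mxE mulr1.
have [a0|a0] := eqVneq a 0; first by rewrite a0.
have s0 : \sum_i v 0 i = 0 by move/eqP: sumv; rewrite mulf_eq0 (negPf a0) => /eqP.
have vA : v *m A = (lam - a) *: v.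
  have vJ : v *m (const_mx 1 : 'M_n) = 0.
    apply/rowP => j; rewrite !mxE -[RHS]s0; apply: eq_bigr => i _.
    by rewrite mxE mulr1.
  rewrite scalerBl -vB /B mulmxDr mulmxBr mul_mx_scalar -scalemxAr vJ scaler0 addr0.
  by rewrite opprB addrC subrK.
have ev : eigenvalue A (lam - a) by apply/eigenvalueP; exists v.
have [ak|ak] := eqVneq (lam - a) k%:R.
  rewrite ak in vA; have vc := eigenvector_top vA; case/eqP: v0.
  apply/rowP => i; rewrite mxE; move: s0.
  rewrite (eq_bigr (fun=> v 0 i)) => [|j _]; last exact: vc.
  by rewrite sumr_const card_ord -mulr_natr => /eqP; rewrite mulf_eq0 (negPf nR0) orbF => /eqP.
have [aN|aN] := eqVneq (lam - a) (- k%:R).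
  have -> : a = lam + k%:R by rewrite -(opprK k%:R) -aN; ring.
  by rewrite addr_ge0.
have := spec ev ak aN; rewrite ler_norml => /andP[_]; lra.
Qed.

(** The form of [B] is evaluated at the indicator vector of [X]. *)
Lemma mixing (X : {set V}) :
  \sum_(u in X) \sum_(w in X) (G u w)%:R <=
  lam * #|X|%:R + (k%:R - lam) / n%:R * #|X|%:R ^+ 2.
Proof.
pose x : 'rV[R]_n := \row_i (enum_val i \in X)%:R.
have symB : B^T = B.
  by rewrite /B linearD linearB /= tr_scalar_mx adjmx_sym linearZ /= trmx_const.
have xX (F : V -> R) : \sum_i x 0 i * F (enum_val i) = \sum_(u in X) F u.
  rewrite [RHS]big_mkcond /= [RHS]big_enum_val /=; apply: eq_bigr => i _.
  by rewrite mxE; case: ifP; rewrite ?mul1r ?mul0r.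
have := symmetric_psd symB mixing_psd x.
rewrite /B mulmxDr mulmxBr mulmxDl mulmxBl [X in 0 <= X]mxE [X in _ <= X + _]mxE.
have -> : (x *m lam%:M *m x^T) 0 0 = lam * #|X|%:R.
  rewrite mul_mx_scalar -scalemxAl mxE; congr (_ * _); rewrite mxE.
  under eq_bigr do rewrite [X in _ * X]mxE [X in _ * X]mxE.
  by rewrite (xX (fun u => (u \in X)%:R)) -sum1_card natr_sum; apply: eq_bigr => u ->.
have -> : (- (x *m A *m x^T)) 0 0 = - \sum_(u in X) \sum_(w in X) (G u w)%:R.
  rewrite mxE -mulmxA mxE; congr (- _).
  rewrite -(xX (fun u => \sum_(w in X) (G u w)%:R)); apply: eq_bigr => i _.
  congr (_ * _); rewrite mxE -(xX (fun w => (G (enum_val i) w)%:R)).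
  by apply: eq_bigr => j _; rewrite mulrC [X in X * _]mxE [X in _ * X]mxE.
have -> : (x *m (((k%:R - lam) / n%:R) *: const_mx 1) *m x^T) 0 0 =
    (k%:R - lam) / n%:R * #|X|%:R ^+ 2.
  rewrite -scalemxAr -scalemxAl mxE; congr (_ * _); rewrite mxE.
  have cX : \sum_i x 0 i = #|X|%:R.
    transitivity (\sum_i x 0 i * 1); first by apply: eq_bigr => i _; rewrite mulr1.
    by rewrite (xX (fun=> 1)) -sum1_card natr_sum.
  rewrite expr2 -{2}cX mulr_sumr; apply: eq_bigr => i _; rewrite mxE.
  rewrite [X in _ * X]mxE; congr (_ * _); rewrite -cX; apply: eq_bigr => j _.
  by rewrite [X in _ * X]mxE mulr1.
lra.
Qed.

End Mixing.

(** * Rigidity after deletion of a vertex *)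

Section EdgeCount.
Variables (V : finType) (G : sgraph V).

Lemma gedges_card2 e : e \in gedges G -> #|e| = 2%N.
Proof.
case/imsetP => -[u w]; rewrite inE /= => uw ->; rewrite cards2.
by rewrite (contraTneq _ uw) // => ->; rewrite adj_irrefl.
Qed.

(** Both sides count the pairs of an edge inside [X] and one of its ends. *)
Lemma ecount_gedges (X : {set V}) :
  (2 * ecount (gedges G) X = \sum_(u in X) #|[set w in X | G u w]|)%N.
Proof.
have -> : (2 * ecount (gedges G) X = \sum_(e in edges_in (gedges G) X) #|e|)%N.
  rewrite mulnC /ecount -sum_nat_const; apply: eq_bigr => e.
  by rewrite inE => /andP[/gedges_card2].
transitivity (\sum_(e in edges_in (gedges G) X) \sum_(u in X) (u \in e : nat))%N.
  apply: eq_bigr => e; rewrite inE => /andP[_ /subsetP eX].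
  rewrite -sum1_card big_mkcond [RHS]big_mkcond; apply: eq_bigr => u _ /=.
  by have := eX u; case: (u \in e) => [->|_] //; case: ifP.
rewrite exchange_big /=; apply: eq_bigr => u uX.
transitivity #|[set e in edges_in (gedges G) X | u \in e]|.
  rewrite -sum1_card big_mkcond [RHS]big_mkcond; apply: eq_bigr => e _ /=.
  by rewrite [in RHS]inE; case: (e \in _) => //=; case: (u \in e).
rewrite -(card_imset _ (@set2_inj _ u)).
apply: eq_card => e; rewrite in_set; apply/andP/imsetP => [[]|[w]].
  rewrite inE => /andP[/imsetP[[a b]]]; rewrite inE /= => ab ->.
  rewrite subUset !sub1set => /andP[aX bX]; rewrite !inE => /orP[]/eqP ->.
    by exists b; rewrite ?inE ?bX.
  by exists a; [rewrite inE aX adj_sym|rewrite setUC].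
rewrite inE => /andP[wX uw] ->; split; last by rewrite !inE eqxx.
by rewrite inE mem_gedges uw subUset !sub1set uX wX.
Qed.

Lemma ecount_clique (X : {set V}) : (2 * ecount (gedges G) X <= #|X| * #|X|.-1)%N.
Proof.
rewrite ecount_gedges -sum_nat_const; apply: leq_sum => u uX.
rewrite -(leq_add2l 1) (_ : 1 + #|X|.-1 = #|X|)%N; last by rewrite (cardD1 u) uX.
rewrite (cardsD1 u X) uX leq_add2l subset_leq_card //.
apply/subsetP => w; rewrite !inE => /andP[-> uw]; rewrite andbT.
by apply: contraTneq uw => ->; rewrite adj_irrefl.
Qed.

Lemma ecount_del k v : regular G k -> (2 * ecount (gedges G) [set~ v] + 2 * k = k * #|V|)%N.
Proof.
move=> reg; rewrite ecount_gedges.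
have -> : (k * #|V| = k + \sum_(u in [set~ v]) k)%N.
  by rewrite sum_nat_const cardsC1 -mulSn prednK 1?mulnC // (cardD1 v).
have degv : (\sum_(u in [set~ v]) G u v = k)%N.
  rewrite -(reg v) -sum1_card big_mkcond [RHS]big_mkcond; apply: eq_bigr => u _.
  rewrite !inE [G v u]adj_sym; case: eqP => [->|_] /=; first by rewrite adj_irrefl.
  by case: (G u v).
rewrite mul2n -addnn addnA [RHS]addnC; congr (_ + _)%N.
rewrite -[X in (_ + X)%N]degv -big_split; apply: eq_bigr => u uv /=.
rewrite -(reg u) (cardsD1 v [set w | G u w]) addnC !inE; congr (_ + _)%N.
by apply: eq_card => w; rewrite !inE.
Qed.

End EdgeCount.

(* The edges of G - v cannot be covered by proper subsets X of total cost
   \sum (2 #|X| - 3) <= 2 #|V| - 6, when every X carries less than its share. *)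
Lemma rigid_del (V : finType) (G : sgraph V) k v : regular G k -> (0 < k)%N ->
  (3 < #|V|)%N ->
  (forall X : {set V}, 1 < #|X| -> #|X| + 2 <= #|V| ->
     2 * ecount (gedges G) X * (2 * #|V| - 6) < (k * #|V| - 2 * k) * (2 * #|X| - 3))%N ->
  exists F, [/\ sparse F, F \subset gedges G,
     forall f, f \in F -> v \notin f & (#|F| + 3 = 2 * #|V|.-1)%N].
Proof.
move=> reg k0 n3 small.
pose E := edges_in (gedges G) [set~ v].
have E2 e : e \in E -> #|e| = 2%N by rewrite inE => /andP[/gedges_card2].
have ES e : e \in E -> e \subset [set~ v] by rewrite inE => /andP[].
have vE e : e \in E -> v \notin e.
  by move/ES => h; apply/negP => /(subsetP h); rewrite !inE eqxx.
have cS : #|[set~ v]| = #|V|.-1 by rewrite cardsC1.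
have S1 : (1 < #|[set~ v]|)%N by rewrite cS; lia.
have [[F [sFE spF cF]]|[T [Tsub cov cost]]] := tight_cover S1 E2 ES.
  exists F; split=> //; last by rewrite cF cS.
    by apply: subset_trans sFE _; apply/subsetP => e; rewrite inE => /andP[].
  by move=> f /(subsetP sFE)/vE.
exfalso; have cE := ecount_del v reg; rewrite cS in cost Tsub.
have EX (X : {set V}) : X \in T -> ecount E X = ecount (gedges G) X.
  case/Tsub => sX _ _; apply: eq_card => e; rewrite !in_set.
  by case: (e \in gedges G) => //=; apply: andb_idl => eX; apply: subset_trans sX.
pose m := ecount (gedges G) [set~ v]; rewrite -/m in cE.
have cov' : (m <= \sum_(X in T) ecount E X)%N by exact: cov.
(* The 1 records strictness. After summation it leaves a surplus [#|T|], which is positive because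
   the sets of [T] cover the [m] edges. *)
have each X : X \in T -> (ecount E X * (2 * #|V| - 6) + 1 <= m * (2 * #|X| - 3))%N.
  move=> XT; have [sX X1 X2] := Tsub X XT.
  have := small X X1; rewrite EX //.
  have -> : (k * #|V| - 2 * k = 2 * m)%N by lia.
  rewrite -!mulnA ltn_pmul2l // addn1; apply; lia.
have : (\sum_(X in T) (ecount E X * (2 * #|V| - 6) + 1) <=
        \sum_(X in T) m * (2 * #|X| - 3))%N.
  exact: leq_sum.
rewrite big_split -big_distrl -big_distrr /= sum1_card => h.
have m0 : (0 < m)%N by nia.
have T0 : (0 < #|T|)%N.
  rewrite lt0n; apply: contraTneq cov' => /cards0_eq ->; rewrite big_set0; lia.
move: h cov' cost; set s1 := (\sum_(X in T) ecount E X)%N.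
set s2 := (\sum_(X in T) (2 * #|X| - 3))%N => h cov' cost.
have l1 : (m * (2 * #|V| - 6) <= s1 * (2 * #|V| - 6))%N by rewrite leq_mul2r cov' orbT.
have l2 : (m * s2 <= m * (2 * #|V| - 6))%N by rewrite leq_mul2l; apply/orP; right; lia.
have := leq_trans (leq_trans h l2) l1.
by rewrite -[X in (_ <= X)%N]addn0 leq_add2l leqNgt T0.
Qed.


(* The difference of the two sides is concave in x, so only its values at the
   end points x = 6 and x = n - 2 matter. *)
Lemma edge_share (R : realFieldType) (k s n x e : R) :
  8 < n -> s <= k -> 6 <= x -> x + 2 <= n ->
  0 < 9 * k * n * (n - 2) - (6 * s * n + 36 * (k - s)) * (2 * n - 6) ->
  0 < k * n * (2 * n - 7) - (s * n + (k - s) * (n - 2)) * (2 * n - 6) ->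
  e <= s * x + (k - s) / n * x ^+ 2 ->
  e * (2 * n - 6) < (k * n - 2 * k) * (2 * x - 3).
Proof.
move=> n8 sk x6 xn g6 gn he; have n0 : 0 < n by apply: lt_trans n8.
rewrite -(ltr_pM2l n0).
apply: (@le_lt_trans _ _ ((s * n * x + (k - s) * x ^+ 2) * (2 * n - 6))).
  rewrite mulrA ler_wpM2r //; first by lra.
  have -> : s * n * x + (k - s) * x ^+ 2 = n * (s * x + (k - s) / n * x ^+ 2).
    by field; rewrite gt_eqF.
  by rewrite ler_pM2l.
(* The end points are [n - 8] apart: [(n - 8) * g] is the linear interpolation of the end values
   plus a nonnegative term from concavity. *)
rewrite -subr_gt0 -(pmulr_rgt0 _ (_ : 0 < n - 8)) ?subr_gt0 //.
set g := (X in 0 < (n - 8) * X).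
have -> : (n - 8) * g =
  (n - 2 - x) * (9 * k * n * (n - 2) - (6 * s * n + 36 * (k - s)) * (2 * n - 6)) +
  (x - 6) * ((n - 2) * (k * n * (2 * n - 7) - (s * n + (k - s) * (n - 2)) * (2 * n - 6))) +
  (k - s) * (2 * n - 6) * ((x - 6) * (n - 2 - x)) * (n - 8) by rewrite /g; ring.
have nx : 0 <= n - 2 - x by lra.
have n2 : 0 < n - 2 by lra.
have n6 : 0 <= 2 * n - 6 by lra.
have n8' : 0 <= n - 8 by rewrite subr_ge0 ltW.
have x6' : 0 <= x - 6 by rewrite subr_ge0.
apply: ltr_wpDr; first by rewrite !mulr_ge0 // subr_ge0.
have [->|xx] := eqVneq x 6.
  by rewrite subrr mul0r addr0 mulr_gt0 //; lra.
rewrite ltr_wpDl //; first by rewrite mulr_ge0 // ltW.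
by rewrite !mulr_gt0 // lt0r x6' subr_eq0 xx.
Qed.

(** On at most 5 vertices it suffices to count all pairs; [e] stands for twice the number of
    edges. *)
Lemma clique_share (k x n e : nat) : (6 <= k)%N -> (8 < n)%N -> (1 < x <= 5)%N ->
  (e <= x * x.-1)%N -> (e * (2 * n - 6) < (k * n - 2 * k) * (2 * x - 3))%N.
Proof.
move=> k6 n8 /andP[x1 x5] ex.
have l1 : (6 * (n - 2) * (2 * x - 3) <= (k * n - 2 * k) * (2 * x - 3))%N.
  by rewrite [(2 * k)%N]mulnC -mulnBr leq_mul2r leq_mul2r k6 !orbT.
apply: leq_trans l1; apply: leq_ltn_trans (_ : x * x.-1 * (2 * n - 6) < _)%N.
  by rewrite leq_mul2r ex orbT.
by case: x x1 x5 {ex} => [|[|[|[|[|[|x]]]]]] //= _ _; lia.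
Qed.

(** * Global rigidity of Ramanujan graphs *)

Lemma enorm_sqd (R : realType) (V : finType) (p : V -> 'rV[R]_2) u v :
  enorm (p u - p v) = Num.sqrt (sqd (fun u k => p u 0 k) u v).
Proof. by congr Num.sqrt; apply: eq_bigr => i _; rewrite !mxE. Qed.

Lemma globally_rigid_vertex_redundant (R : realType) (V : finType) (G : sgraph V) k :
  connected G -> regular G k -> (3 <= k)%N ->
  (forall v, exists F, [/\ sparse F, F \subset gedges G,
     forall f, f \in F -> v \notin f & (#|F| + 3 = 2 * #|V|.-1)%N]) ->
  globally_rigid R G 2.
Proof.
move=> conG reg k3 rig.
have [x gx] := exists_alg_independent R (V * 'I_2)%type.
pose p v : 'rV[R]_2 := \row_k x (v, k).
have gp : generic p.
  move=> P P0; apply: gx; rewrite -[RHS]P0; apply: mpoly.meval_eq => i.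
  by rewrite mxE -surjective_pairing.
exists p; split=> // q eq_pq u v; rewrite !enorm_sqd; congr Num.sqrt.
apply: (globally_rigid_coords gp conG) => [w|//|a b ab]; first by rewrite reg.
have /eqP := eq_pq a b ab; rewrite !enorm_sqd eqr_sqrt => [/eqP//||];
  by apply: sumr_ge0 => i _; rewrite sqr_ge0.
Qed.

(** The number [s] bounds [2 * Num.sqrt (k%:R - 1)] from above and keeps square roots out of the
    later inequalities. *)
Lemma ramanujan_mixing (R : realType) (V : finType) (G : sgraph V) k (s : R)
  (X : {set V}) : ramanujan R G k -> (0 < #|V|)%N -> 0 <= s -> 4 * (k%:R - 1) <= s ^+ 2 ->
  (2 * ecount (gedges G) X)%:R <=
    s * #|X|%:R + (k%:R - s) / #|V|%:R * #|X|%:R ^+ 2.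
Proof.
move=> [_ conG reg spec] n0 s0 ks.
have sqrt_le : 2 * Num.sqrt (k%:R - 1) <= s.
  have -> : s = 2 * (s / 2) by field.
  rewrite ler_pM2l // -[s / 2]ger0_norm ?divr_ge0 // -sqrtr_sqr ler_wsqrtr //.
  by rewrite expr_div_n ler_pdivlMr ?exprn_gt0 // mulrC; apply: le_trans ks; lra.
have := mixing conG reg s0 n0 (fun a ev ak aN => le_trans (spec a ev ak aN) sqrt_le) X.
apply: le_trans; rewrite ecount_gedges natr_sum le_eqVlt; apply/orP; left; apply/eqP.
apply: eq_bigr => u _; rewrite -natr_sum; congr _%:R.
rewrite -sum1_card big_mkcond [RHS]big_mkcond; apply: eq_bigr => w _ /=.
by rewrite inE; case: (w \in X); case: (G u w).
Qed.

(** The two polynomial hypotheses are the end point conditions of [edge_share]. The second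
    expression equals [(3 * k - 4 * s) * n - 12 * (k - s)], and the first is [3 * (n - 6)] times
    it. *)
Lemma ramanujan_globally_rigid (R : realType) (V : finType) (G : sgraph V) k (s : R)
    (n := #|V|%:R : R) :
  ramanujan R G k -> (6 <= k)%N -> (8 < #|V|)%N -> 0 <= s <= k%:R ->
  4 * (k%:R - 1) <= s ^+ 2 ->
  0 < 9 * k%:R * n * (n - 2) - (6 * s * n + 36 * (k%:R - s)) * (2 * n - 6) ->
  0 < k%:R * n * (2 * n - 7) - (s * n + (k%:R - s) * (n - 2)) * (2 * n - 6) ->
  globally_rigid R G 2.
Proof.
move=> ramG k6 n8 /andP[s0 sk] ks g6 gn; have [k3 conG reg _] := ramG.
apply: (globally_rigid_vertex_redundant R conG reg k3) => v.
apply: (rigid_del v reg) => [||X X1 X2]; [lia|lia|].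
have [X5|X6] := leqP #|X| 5.
  by apply: clique_share (ecount_clique G X); rewrite ?X1.
have := ramanujan_mixing X ramG (ltn_trans (isT : 0 < 8)%N n8) s0 ks.
have n8R : 8 < n by rewrite /n (ltr_nat _ 8).
have X6R : 6 <= #|X|%:R :> R by rewrite (ler_nat _ 6).
have X2R : #|X|%:R + 2 <= n by rewrite /n -(natrD _ _ 2) ler_nat.
move=> /(edge_share n8R sk X6R X2R g6 gn).
rewrite -(ltr_nat R) [X in _ -> X < _]natrM [X in _ -> _ < X]natrM.
have c1 : (6 <= 2 * #|V|)%N by clear -n8; lia.
have c2 : (3 <= 2 * #|X|)%N by clear -X1; lia.
have c3 : (2 * k <= k * #|V|)%N by rewrite mulnC leq_mul2l (leq_trans _ n8) ?orbT.
by rewrite (natrB _ c1) (natrB _ c2) (natrB _ c3) !natrM.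
Qed.

Theorem theorem1p2 (R : realType) :
  (forall (V : finType) (G : sgraph V),
     ramanujan R G 7 -> (22 <= #|V|)%N -> globally_rigid R G 2) /\
  (forall (V : finType) (G : sgraph V),
     ramanujan R G 6 -> (329 <= #|V|)%N -> globally_rigid R G 2).
Proof.
split=> V G ramG nV.
  have nR : 22 <= #|V|%:R :> R by rewrite (ler_nat _ 22).
  (* The value [s] lies between [2 * sqrt 6], about 4.899, and [21 / 4], where [3 * k - 4 * s]
     changes sign. *)
  by apply: (ramanujan_globally_rigid (s := 49%:R / 10%:R) ramG) => //; [lia|lra|lra|nra|nra].
have nR : 329 <= #|V|%:R :> R by rewrite (ler_nat _ 329).
(* For degree 6 the window is narrower, from [2 * sqrt 5], about 4.472, to [9 / 2]; here [s] is
   4.48. *)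
by apply: (ramanujan_globally_rigid (s := 112%:R / 25%:R) ramG) => //; [lia|lra|lra|nra|nra].
Qed.
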